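(* There exists a monad $T$ on the category $\mathbf{BPos}$ of bounded posets, with Eilenberg-Moore category $\mathbf{BPos}^T$ equivalent to the category $\omega\mathbf{EM}$ of $\omega$-effect monoids, such that the real unit interval $[0,1]$ (regarded as an $\omega$-effect monoid with its usual order, partial addition, complement $a\mapsto 1-a$ and multiplication) is, up to isomorphism, the unique non-initial, non-final, irreducible algebra in $\mathbf{BPos}^T\simeq\omega\mathbf{EM}$.
   Context: **Bounded posets.** A poset is bounded when it has a minimum $0$ and a maximum $1$. $\mathbf{BPos}$ is the category of bounded posets and order-preserving maps preserving $0$ and $1$. A bounded poset is $\omega$-complete when every increasing sequence $a_1\leq a_2\leq\cdots$ has a supremum. A monotone map $f$ between $\omega$-complete bounded posets is $\omega$-normal when $f(\bigvee_i x_i)=\bigvee_i f(x_i)$ for every increasing sequence $x_1\leq x_2\leq\cdots$. **Effect algebras.** An effect algebra is a set $E$ with an element $0$, a partial binary operation $\oplus$ and a total unary operation $(\ )^\perp$ such that, writing $a\perp b$ when $a\oplus b$ is defined and $1:=0^\perp$: (i) if $a\perp b$ then $b\perp a$ and $a\oplus b=b\oplus a$; (ii) $a\perp 0$ and $a\oplus 0=a$; (iii) if $a\perp b$ and $(a\oplus b)\perp c$ then $b\perp c$, $a\perp(b\oplus c)$ and $(a\oplus b)\oplus c=a\oplus(b\oplus c)$; (iv) $a^\perp$ is the unique element with $a\oplus a^\perp=1$; (v) if $a\perp 1$ then $a=0$. It is a bounded poset under $a\leq b$ iff $a\oplus c=b$ for some $c$. A homomorphism is a map $f$ with $f(1)=1$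 such that $a\perp b$ implies $f(a)\perp f(b)$ and $f(a\oplus b)=f(a)\oplus f(b)$. **Effect monoids.** An effect monoid is an effect algebra $M$ with a total binary operation $\cdot$ that is associative, satisfies $x\cdot 1=x=1\cdot x$, and is such that $y\perp z$ implies $x\cdot y\perp x\cdot z$, $y\cdot x\perp z\cdot x$, $x\cdot(y\oplus z)=(x\cdot y)\oplus(x\cdot z)$ and $(y\oplus z)\cdot x=(y\cdot x)\oplus(z\cdot x)$. An $\omega$-effect monoid is an effect monoid whose underlying bounded poset is $\omega$-complete. The category $\omega\mathbf{EM}$ has $\omega$-effect monoids as objects and, as morphisms, effect algebra homomorphisms that are $\omega$-normal and preserve the product operation. **Irreducibility.** An object $M$ is irreducible when $M\cong M_1\times M_2$ (categorical product; in $\omega\mathbf{EM}$ the Cartesian product with pointwise operations) implies that $M_1$ or $M_2$ is final. **Unit interval.** On $[0,1]$: $a\perp b$ iff $a\leq 1-b$, $a\oplus b=a+b$, $a^\perp=1-a$, and $\cdot$ is the usual multiplication. *)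

(* Defs.v *)
From HB Require Import structures.
From mathcomp Require Import all_boot all_order all_algebra.
From mathcomp Require Import interval_inference.
From mathcomp Require Import all_classical all_reals.

Set Implicit Arguments.
Unset Strict Implicit.
Unset Printing Implicit Defensive.

Import Order.TTheory GRing.Theory Num.Theory.

Local Obligation Tactic := (try by []).

Reserved Notation "g \c f" (at level 50, left associativity, format "g  \c  f").

Record category := Category {
  ob :> Type;
  hom : ob -> ob -> Type;
  idm : forall a, hom a a;
  comp : forall a b c, hom b c -> hom a b -> hom a c;
  comp1m : forall a b (f : hom a b), comp (idm b) f = f;
  compm1 : forall a b (f : hom a b), comp f (idm a) = f;
  compA : forall a b c d (h : hom c d) (g : hom b c) (f : hom a b),
    comp h (comp g f) = comp (comp h g) f
}.
Arguments hom {c} a b : rename.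
Arguments idm {c} a : rename.
Notation "g \c f" := (comp g f).

Record functor (C D : category) := Functor {
  fob :> C -> D;
  fmap : forall a b, hom a b -> hom (fob a) (fob b);
  fmap1 : forall a, fmap (idm a) = idm (fob a);
  fmapM : forall a b c (g : hom b c) (f : hom a b),
    fmap (g \c f) = fmap g \c fmap f
}.
Arguments fmap {C D} f {a b} : rename.

Program Definition functor_id (C : category) : functor C C :=
  @Functor C C id (fun _ _ f => f) _ _.

Program Definition functor_comp (C D E : category)
    (G : functor D E) (F : functor C D) : functor C E :=
  @Functor C E (fun a => G (F a)) (fun _ _ f => fmap G (fmap F f)) _ _.
Next Obligation. by move=> C D E G F a /=; rewrite !fmap1. Qed.
Next Obligation. by move=> C D E G F a b c g f /=; rewrite !fmapM. Qed.

Record nattrans (C D : category) (F G : functor C D) := Nattrans {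
  component :> forall a, hom (F a) (G a);
  naturality : forall a b (f : hom a b),
    component b \c fmap F f = fmap G f \c component a
}.

Definition is_iso (C : category) (a b : C) (f : hom a b) :=
  exists g : hom b a, g \c f = idm a /\ f \c g = idm b.

Definition isomorphic (C : category) (a b : C) := exists f : hom a b, is_iso f.

Definition naturally_isomorphic (C D : category) (F G : functor C D) :=
  exists t : nattrans F G, forall a, is_iso (t a).

Definition quasi_inverse (C D : category) (F : functor C D) (G : functor D C) :=
  naturally_isomorphic (functor_id C) (functor_comp G F) /\
  naturally_isomorphic (functor_comp F G) (functor_id D).

Definition initial (C : category) (a : C) :=
  forall b : C, exists f : hom a b, forall g : hom a b, g = f.

Definition final (C : category) (a : C) :=
  forall b : C, exists f : hom b a, forall g : hom b a, g = f.

Definition is_product (C : category) (a b p : C)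
    (pa : hom p a) (pb : hom p b) :=
  forall (x : C) (f : hom x a) (g : hom x b),
    exists! h : hom x p, pa \c h = f /\ pb \c h = g.

Definition irreducible (C : category) (m : C) :=
  forall (a b p : C) (pa : hom p a) (pb : hom p b),
    is_product pa pb -> isomorphic m p -> final a \/ final b.

Record monad (C : category) := Monad {
  monad_functor :> functor C C;
  eta : nattrans (functor_id C) monad_functor;
  mu : nattrans (functor_comp monad_functor monad_functor) monad_functor;
  mu_etal : forall a, mu a \c eta (monad_functor a) = idm (monad_functor a);
  mu_etar : forall a, mu a \c fmap monad_functor (eta a) =
    idm (monad_functor a);
  mu_assoc : forall a, mu a \c mu (monad_functor a) =
    mu a \c fmap monad_functor (mu a)
}.

Section EilenbergMoore.
Variables (C : category) (T : monad C).

Record algebra := Algebra {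
  alg_ob :> C;
  alg_str : hom (T alg_ob) alg_ob;
  alg_unit : alg_str \c eta T alg_ob = idm alg_ob;
  alg_mult : alg_str \c mu T alg_ob = alg_str \c fmap T alg_str
}.

Record algebra_hom (A B : algebra) := AlgebraHom {
  alg_hom :> hom (alg_ob A) (alg_ob B);
  alg_homP : alg_hom \c alg_str A = alg_str B \c fmap T alg_hom
}.

Lemma algebra_hom_eq (A B : algebra) (f g : algebra_hom A B) :
  alg_hom f = alg_hom g -> f = g.
Proof.
case: f g => [f fP] [g gP] /= fg; case: _ / fg gP => gP.
by congr AlgebraHom; exact: Prop_irrelevance.
Qed.

Program Definition algebra_id (A : algebra) : algebra_hom A A :=
  @AlgebraHom A A (idm (alg_ob A)) _.
Next Obligation. by move=> A; rewrite fmap1 comp1m compm1. Qed.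

Program Definition algebra_comp (A B D : algebra)
    (g : algebra_hom B D) (f : algebra_hom A B) : algebra_hom A D :=
  @AlgebraHom A D (alg_hom g \c alg_hom f) _.
Next Obligation.
by move=> A B D g f; rewrite fmapM -compA alg_homP !compA alg_homP.
Qed.

Program Definition EilenbergMoore : category :=
  @Category algebra algebra_hom algebra_id algebra_comp _ _ _.
Next Obligation. by move=> A B f; apply: algebra_hom_eq; exact: comp1m. Qed.
Next Obligation. by move=> A B f; apply: algebra_hom_eq; exact: compm1. Qed.
Next Obligation.
by move=> A B D E h g f; apply: algebra_hom_eq; exact: compA.
Qed.

End EilenbergMoore.

Local Open Scope order_scope.
Local Open Scope classical_set_scope.

(* The display only selects notations; all objects of BPos share this one.    *)
(* The choice structure carried by a tbPOrderType is invisible to morphisms,  *)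
(* and classically every type has one.                                        *)
Fact bposet_display : Order.disp_t. Proof. exact: Order.Disp tt tt. Qed.

Definition bposet := tbPOrderType bposet_display.

Record bposet_hom (X Y : bposet) := BPosetHom {
  bposet_fun :> X -> Y;
  bposet_homo : {homo bposet_fun : x y / x <= y};
  bposet_hom0 : bposet_fun \bot = \bot;
  bposet_hom1 : bposet_fun \top = \top
}.

Lemma bposet_hom_eq (X Y : bposet) (f g : bposet_hom X Y) :
  bposet_fun f = bposet_fun g -> f = g.
Proof.
case: f g => [f ? ? ?] [g Hg g0 g1] /= fg; case: _ / fg Hg g0 g1 => *.
by congr BPosetHom; exact: Prop_irrelevance.
Qed.

Program Definition bposet_id (X : bposet) : bposet_hom X X :=
  @BPosetHom X X id _ _ _.
Next Obligation. by move=> X x y. Qed.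

Program Definition bposet_comp (X Y Z : bposet)
    (g : bposet_hom Y Z) (f : bposet_hom X Y) : bposet_hom X Z :=
  @BPosetHom X Z (g \o f) _ _ _.
Next Obligation. by move=> X Y Z g f x y xy /=; do 2 apply: bposet_homo. Qed.
Next Obligation. by move=> X Y Z g f /=; rewrite !bposet_hom0. Qed.
Next Obligation. by move=> X Y Z g f /=; rewrite !bposet_hom1. Qed.

Program Definition BPos : category :=
  @Category bposet bposet_hom bposet_id bposet_comp _ _ _.
Next Obligation. by move=> *; apply: bposet_hom_eq. Qed.
Next Obligation. by move=> *; apply: bposet_hom_eq. Qed.
Next Obligation. by move=> *; apply: bposet_hom_eq. Qed.

Definition omega_complete (X : bposet) :=
  forall u : nat -> X, {homo u : m n / (m <= n)%N >-> m <= n} ->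
    supremums (range u) !=set0.

Definition omega_normal (X Y : bposet) (f : X -> Y) :=
  forall (u : nat -> X) (s : X), {homo u : m n / (m <= n)%N >-> m <= n} ->
    supremums (range u) s -> supremums (range (f \o u)) (f s).

(* The partial sum is encoded with an option: oplus a b = None means that the *)
(* sum of a and b is undefined.                                               *)
Record effect_algebra := EffectAlgebra {
  ea_sort :> choiceType;
  ea0 : ea_sort;
  oplus : ea_sort -> ea_sort -> option ea_sort;
  orth : ea_sort -> ea_sort;
  oplusC : forall a b c, oplus a b = Some c -> oplus b a = Some c;
  oplus0 : forall a, oplus a ea0 = Some a;
  oplusA : forall a b c ab abc,
    oplus a b = Some ab -> oplus ab c = Some abc ->
    exists2 bc, oplus b c = Some bc & oplus a bc = Some abc;
  oplus_orth : forall a, oplus a (orth a) = Some (orth ea0);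
  orth_unique : forall a b, oplus a b = Some (orth ea0) -> b = orth a;
  oplus1_eq0 : forall a b, oplus a (orth ea0) = Some b -> a = ea0
}.
Arguments ea0 {e}.
Arguments oplus {e}.
Arguments orth {e}.

Definition ea1 {E : effect_algebra} : E := orth ea0.

Definition ea_le {E : effect_algebra} (a b : E) :=
  exists c, oplus a c = Some b.

Section EffectAlgebraOrder.
Variable E : effect_algebra.
Implicit Types a b c : E.

Lemma oplus_cancel a b c d : oplus a b = Some d -> oplus a c = Some d -> b = c.
Proof.
move=> ab ac; have dd := oplus_orth d.
have [x bx ax] := oplusA ab dd; have [y cy ay] := oplusA ac dd.
have xb : oplus (orth d) a = Some (orth b).
  have [z az bz] := oplusA (oplusC ab) dd.
  by rewrite -(orth_unique bz); exact: oplusC.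
have xc : oplus (orth d) a = Some (orth c).
  have [z az cz] := oplusA (oplusC ac) dd.
  by rewrite -(orth_unique cz); exact: oplusC.
have bc : orth b = orth c by move: xb; rewrite xc => -[->].
rewrite (orth_unique (oplusC (oplus_orth b))) bc.
by rewrite -(orth_unique (oplusC (oplus_orth c))).
Qed.

Lemma ea_le_refl a : ea_le a a.
Proof. by exists ea0; exact: oplus0. Qed.

Lemma ea_le_trans b a c : ea_le a b -> ea_le b c -> ea_le a c.
Proof. by move=> [x ax] [y by_]; have [z _] := oplusA ax by_; exists z. Qed.

Lemma ea_le_anti a b : ea_le a b -> ea_le b a -> a = b.
Proof.
move=> [x ax] [y by_]; have [z xy az] := oplusA ax by_.
have z0 := oplus_cancel az (oplus0 a); rewrite {}z0 in xy.
have [w yw xw] := oplusA xy (oplus_orth ea0).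
have y0 := oplus1_eq0 yw; rewrite {}y0 oplus0 in by_.
by case: by_.
Qed.

Lemma ea_ge0 a : ea_le ea0 a.
Proof. by exists a; exact/oplusC/oplus0. Qed.

Lemma ea_le1 a : ea_le a ea1.
Proof. by exists (orth a); exact: oplus_orth. Qed.

End EffectAlgebraOrder.

Definition ea_poset (E : effect_algebra) : Type := E.

Section EffectAlgebraPoset.
Variable E : effect_algebra.
Local Notation P := (ea_poset E).

HB.instance Definition _ := Choice.on P.

Let le (a b : P) : bool := `[< ea_le (a : E) b >].
Let lt (a b : P) : bool := (b != a) && le a b.

Fact ea_poset_lt_def (a b : P) : lt a b = (b != a) && le a b.
Proof. by []. Qed.

Fact ea_poset_refl : reflexive le.
Proof. by move=> a; apply/asboolP; exact: ea_le_refl. Qed.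

Fact ea_poset_anti : antisymmetric le.
Proof. by move=> a b /andP[/asboolP ab /asboolP ba]; exact: ea_le_anti. Qed.

Fact ea_poset_trans : transitive le.
Proof.
by move=> b a c /asboolP ab /asboolP bc; apply/asboolP; exact: ea_le_trans bc.
Qed.

HB.instance Definition _ := Order.isPOrder.Build bposet_display P
  ea_poset_lt_def ea_poset_refl ea_poset_anti ea_poset_trans.

Fact ea_poset_le0x (a : P) : (ea0 : P) <= a.
Proof. by apply/asboolP; exact: ea_ge0. Qed.

Fact ea_poset_lex1 (a : P) : a <= (ea1 : P).
Proof. by apply/asboolP; exact: ea_le1. Qed.

HB.instance Definition _ :=
  Order.hasBottom.Build bposet_display P ea_poset_le0x.
HB.instance Definition _ := Order.hasTop.Build bposet_display P ea_poset_lex1.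

End EffectAlgebraPoset.

Definition ea_bposet (E : effect_algebra) : bposet := ea_poset E.

Lemma ea_bposet_leP (E : effect_algebra) (a b : ea_bposet E) :
  a <= b <-> exists c : E, oplus (a : E) c = Some (b : E).
Proof. by split => [/asboolP|?] //; apply/asboolP. Qed.

Record ea_hom (E F : effect_algebra) := EAHom {
  ea_fun :> E -> F;
  ea_hom1 : ea_fun ea1 = ea1;
  ea_homD : forall a b c, oplus a b = Some c ->
    oplus (ea_fun a) (ea_fun b) = Some (ea_fun c)
}.

Record effect_monoid := EffectMonoid {
  em_ea :> effect_algebra;
  emul : em_ea -> em_ea -> em_ea;
  emulA : associative emul;
  emulx1 : right_id ea1 emul;
  emul1x : left_id ea1 emul;
  emulDr : forall x y z w : em_ea, oplus y z = Some w ->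
    oplus (emul x y) (emul x z) = Some (emul x w);
  emulDl : forall x y z w : em_ea, oplus y z = Some w ->
    oplus (emul y x) (emul z x) = Some (emul w x)
}.
Arguments emul {e}.

Record omega_effect_monoid := OmegaEffectMonoid {
  oem_em :> effect_monoid;
  oem_complete : omega_complete (ea_bposet oem_em)
}.

Record oem_hom (M N : omega_effect_monoid) := OEMHom {
  oem_ea_hom :> ea_hom M N;
  oem_normal : @omega_normal (ea_bposet M) (ea_bposet N) oem_ea_hom;
  oem_homM : forall x y, oem_ea_hom (emul x y) =
    emul (oem_ea_hom x) (oem_ea_hom y)
}.

Lemma oem_hom_eq (M N : omega_effect_monoid) (f g : oem_hom M N) :
  ea_fun f = ea_fun g -> f = g.
Proof.
case: f g => [[f f1 fD] fn fM] [[g g1 gD] gn gM] /= fg.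
case: _ / fg g1 gD gn gM => g1 gD.
rewrite (Prop_irrelevance g1 f1) (Prop_irrelevance gD fD) => gn gM.
by congr OEMHom; exact: Prop_irrelevance.
Qed.

Program Definition oem_id (M : omega_effect_monoid) : oem_hom M M :=
  @OEMHom M M (@EAHom M M id _ _) _ _.
Next Obligation. by move=> M u s. Qed.

Program Definition oem_comp (M N P : omega_effect_monoid)
    (g : oem_hom N P) (f : oem_hom M N) : oem_hom M P :=
  @OEMHom M P (@EAHom M P (g \o f) _ _) _ _.
Next Obligation. by move=> M N P g f /=; rewrite !ea_hom1. Qed.
Next Obligation. by move=> M N P g f a b c abc /=; do 2 apply: ea_homD. Qed.
Next Obligation.
move=> M N P g f u s u_homo us.
apply: (@oem_normal _ _ g (f \o u)); last exact: oem_normal.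
move=> m n mn; have /ea_bposet_leP[c uc] := u_homo _ _ mn.
by apply/ea_bposet_leP; exists (f c); exact: ea_homD.
Qed.
Next Obligation. by move=> M N P g f x y /=; rewrite !oem_homM. Qed.

Program Definition OmegaEM : category :=
  @Category omega_effect_monoid oem_hom oem_id oem_comp _ _ _.
Next Obligation. by move=> *; apply: oem_hom_eq. Qed.
Next Obligation. by move=> *; apply: oem_hom_eq. Qed.
Next Obligation. by move=> *; apply: oem_hom_eq. Qed.

Section UnitInterval.
Local Open Scope ring_scope.
Variable R : realType.
Implicit Types x y z : {i01 R}.

(* insub returns None when the real sum lies outside `[0, 1].                 *)
Definition i01_oplus x y : option {i01 R} := insub (x%:num + y%:num).
Definition i01_orth x : {i01 R} := (1 - x%:num)%:i01.
Definition i01_mul x y : {i01 R} := (x%:num * y%:num)%:i01.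

Lemma i01_oplusP x y z : i01_oplus x y = Some z <-> x%:num + y%:num = z%:num.
Proof.
split=> [|xy]; first by rewrite /i01_oplus; case: insubP => // w _ <- [<-].
by rewrite /i01_oplus xy; exact: valK.
Qed.

Lemma i01_oplus_def x y : (i01_oplus x y : bool) = (x%:num <= 1 - y%:num).
Proof.
rewrite lerBrDr; apply/idP/idP => [|xy1].
  case E: (i01_oplus x y) => [z|//] _.
  by move/i01_oplusP: E => ->.
have xy0 : 0 <= x%:num + y%:num by rewrite addr_ge0.
by have /i01_oplusP -> : x%:num + y%:num = (Itv01 xy0 xy1)%:num.
Qed.

Program Definition i01_effect_algebra : effect_algebra :=
  @EffectAlgebra {i01 R} 0%:i01 i01_oplus i01_orth _ _ _ _ _ _.
Next Obligation. by move=> x y z; rewrite !i01_oplusP addrC. Qed.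
Next Obligation. by move=> x; apply/i01_oplusP; rewrite /= addr0. Qed.
Next Obligation.
move=> x y z xy xyz /i01_oplusP xyE /i01_oplusP xyzE.
have yz1 : y%:num + z%:num <= 1.
  apply: (@le_trans _ _ xyz%:num) => //.
  by rewrite -xyzE -xyE -addrA lerDr.
have yz0 : 0 <= y%:num + z%:num by rewrite addr_ge0.
exists (Itv01 yz0 yz1); apply/i01_oplusP => //=.
by rewrite -xyzE -xyE addrA.
Qed.
Next Obligation. by move=> x; apply/i01_oplusP => /=; rewrite subr0 subrKC. Qed.
Next Obligation.
move=> x y /i01_oplusP /= xy; apply: val_inj => /=.
by rewrite -[y%:num](addKr x%:num) xy subr0 addrC.
Qed.
Next Obligation.
move=> x y /i01_oplusP /= xy; apply: val_inj => /=; apply/le_anti/andP; split=> //.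
by rewrite -(lerD2r 1) add0r -[X in _ + X]subr0 xy.
Qed.

Program Definition i01_effect_monoid : effect_monoid :=
  @EffectMonoid i01_effect_algebra i01_mul _ _ _ _ _.
Next Obligation. by move=> x y z; apply: val_inj; rewrite /= mulrA. Qed.
Next Obligation. by move=> x; apply: val_inj; rewrite /= subr0 mulr1. Qed.
Next Obligation. by move=> x; apply: val_inj; rewrite /= subr0 mul1r. Qed.
Next Obligation.
by move=> x y z w /i01_oplusP yz; apply/i01_oplusP; rewrite /= -mulrDr yz.
Qed.
Next Obligation.
by move=> x y z w /i01_oplusP yz; apply/i01_oplusP; rewrite /= -mulrDl yz.
Qed.

Lemma i01_leP (x y : {i01 R}) :
  ((x : ea_bposet i01_effect_monoid) <= y)%O = (x%:num <= y%:num).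
Proof.
apply/idP/idP => [/ea_bposet_leP[z /i01_oplusP <-]|xy]; first by rewrite lerDl.
have yx0 : 0 <= y%:num - x%:num by rewrite subr_ge0.
have yx1 : y%:num - x%:num <= 1.
  by rewrite lerBlDr (le_trans (ltac:(done) : y%:num <= 1)) // lerDl.
apply/ea_bposet_leP; exists (Itv01 yx0 yx1).
by apply/i01_oplusP; rewrite /= subrKC.
Qed.

Lemma i01_complete : omega_complete (ea_bposet i01_effect_monoid).
Proof.
move=> u _; pose A : set R := [set (u n : {i01 R})%:num | n in setT].
have A1 : ubound A 1 by move=> _ [n _ <-].
have hA : has_sup A by split; [exists (u 0%N : {i01 R})%:num; exists 0%N|exists 1].
have sA n : (u n : {i01 R})%:num <= sup A.
  by apply: sup_upper_bound => //; exists n.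
have s0 : 0 <= sup A by apply: le_trans (sA 0%N).
have s1 : sup A <= 1 by apply: ge_sup => //; case: hA.
exists (Itv01 s0 s1); split=> [_ [n _ <-]|y yu]; rewrite i01_leP//=.
apply: ge_sup; first by case: hA.
by move=> _ [n _ <-]; rewrite -i01_leP; apply: yu; exists n.
Qed.

Definition unit_interval : OmegaEM := OmegaEffectMonoid i01_complete.

End UnitInterval.

(* Main.v *)
Require Import Defs.
From HB Require Import structures.
From mathcomp Require Import all_boot all_order all_algebra.
From mathcomp Require Import interval_inference lra.
From mathcomp Require Import all_classical all_reals.
Import Defs.

(** Monadicity. The sum of an effect algebra is defined on pairs that the
    underlying poset does not know before the sum itself is known, but the
    difference [b - a] is defined exactly on the pairs [a <= b]. So an
    omega-effect monoid is a bounded poset with operations whose arities are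
    posets: differences of chains of length two, products of pairs, suprema of
    increasing sequences ([dmonoid], [dmonoid_oem]). The free omega-effect
    monoid on a bounded poset consists of the terms in these operations that
    are defined in every model, modulo equality in every model
    ([free_construction]). For an algebra [alpha] of the resulting monad, the
    unit is monotone and so turns a chain of elements into a chain of
    generators, which can be operated upon formally; applying [alpha] defines
    the operations of the algebra. Since [alpha] commutes with the operations
    ([alg_str_diff], [alg_str_mul], [alg_str_sup]) and the hypotheses of the
    axioms are inequalities between elements, which the unit preserves, all
    axioms are inherited from the free object ([alg_dmonoid]).
    This gives the equivalence [alg_oem_quasi_inverse].

    Irreducible objects. An idempotent [e] is central and splits [M] as the
    product of the corners below [e] and [orth e], so irreducibility says that
    only [0] and [1] are idempotent ([irreducible_connected],
    [connected_irreducible]); in [0, 1] this is clear. Conversely, let [M]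
    have this property, and be neither final nor initial.

    - There are no zero divisors: if [x * y = 0] then [y] lies below the
      infimum of the powers of [orth x], which is idempotent
      ([connected_integral]).
    - There is [h] with [h + h = 1]: as [M] is not initial it has an element
      [a] other than [0] and [1], and a coin of bias [a] can be made fair
      by von Neumann's trick ([half_exists]).
    - Every [a] is comparable with [orth a], that is, with one half: the
      probability that a gambler with odds [a] is ruined solves a quadratic
      equation which factors, and one of the factors must vanish
      ([orth_comparable]). It follows that the order is total
      ([ea_le_total]).
    - Comparing with one half repeatedly gives the binary expansion of each
      element ([dyad_expansion]), hence a map to [0, 1]. It is additive by
      approximation, injective because an omega-complete effect algebra has no
      infinitesimals, multiplicative because an additive map is determined by
      its value at [1], and onto by completeness
      ([measure_isomorphic]). *)

Set Implicit Arguments.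
Unset Strict Implicit.
Unset Printing Implicit Defensive.

Import Order.TTheory GRing.Theory Num.Theory.

Local Open Scope classical_set_scope.
Local Open Scope quotient_scope.
Local Open Scope ring_scope.

(** * Equivalences of categories *)

Section Categories.

Lemma iso_monic (C : category) (a b c : C) (t : hom b c) (f g : hom a b) :
  is_iso t -> t \c f = t \c g -> f = g.
Proof.
by move=> [s [st _]] tfg; rewrite -(comp1m f) -st -compA tfg compA st comp1m.
Qed.

Lemma iso_epic (C : category) (a b c : C) (t : hom a b) (f g : hom b c) :
  is_iso t -> f \c t = g \c t -> f = g.
Proof.
by move=> [s [_ ts]] ftg; rewrite -(compm1 f) -ts compA ftg -compA ts compm1.
Qed.

Lemma is_iso_comp (C : category) (a b c : C) (g : hom b c) (f : hom a b) :
  is_iso g -> is_iso f -> is_iso (g \c f).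
Proof.
move=> [g' [g'g gg']] [f' [f'f ff']]; exists (f' \c g'); split.
  by rewrite compA -(compA f') g'g compm1.
by rewrite compA -(compA g) ff' compm1.
Qed.

Lemma isomorphic_trans (C : category) (a b c : C) :
  isomorphic a b -> isomorphic b c -> isomorphic a c.
Proof. by move=> [f fi] [g gi]; exists (g \c f); exact: is_iso_comp. Qed.

Lemma isomorphic_sym (C : category) (a b : C) :
  isomorphic a b -> isomorphic b a.
Proof. by move=> [f [g [gf fg]]]; exists g, f. Qed.

Lemma isomorphic_fmap (C D : category) (F : functor C D) (a b : C) :
  isomorphic a b -> isomorphic (F a) (F b).
Proof.
move=> [f [g [gf fg]]]; exists (fmap F f), (fmap F g).
by rewrite -!fmapM gf fg !fmap1.
Qed.

Lemma naturally_isomorphic_sym (C D : category) (F G : functor C D) :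
  naturally_isomorphic F G -> naturally_isomorphic G F.
Proof.
move=> [t ti].
have s_ex a : { s : hom (G a) (F a) | s \c t a = idm _ /\ t a \c s = idm _ }.
  exact/cid/ti.
pose s a := sval (s_ex a).
have st a : s a \c t a = idm _ by exact: (svalP (s_ex a)).1.
have ts a : t a \c s a = idm _ by exact: (svalP (s_ex a)).2.
have sN a b (f : hom a b) : s b \c fmap G f = fmap F f \c s a.
  apply: (iso_monic (ti b)); apply: (iso_epic (ti a)).
  by rewrite !compA ts comp1m -!compA st compm1 naturality.
exists (Nattrans sN) => a; exists (t a); by split; [exact: ts|exact: st].
Qed.

Lemma quasi_inverse_sym (C D : category) (F : functor C D) (G : functor D C) :
  quasi_inverse F G -> quasi_inverse G F.
Proof. by move=> [u c]; split; exact: naturally_isomorphic_sym. Qed.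

Section Equivalence.
Variables (C D : category) (F : functor C D) (G : functor D C).

Lemma quasi_inverse_faithful : quasi_inverse F G ->
  forall (a b : C) (f g : hom a b), fmap F f = fmap F g -> f = g.
Proof.
move=> [[t ti] _] a b f g Ffg; apply: (iso_monic (ti b)).
by have := naturality t f; have := naturality t g; rewrite /= Ffg => <- <-.
Qed.

End Equivalence.

Section Equivalence.
Variables (C D : category) (F : functor C D) (G : functor D C).
Hypothesis FG : quasi_inverse F G.

(** The functor [G] is faithful as well, so it suffices to solve [fmap G
    (fmap F f) = fmap G k], where naturality of the unit dictates [f]. *)
Lemma quasi_inverse_full (a b : C) (k : hom (F a) (F b)) :
  exists f : hom a b, fmap F f = k.
Proof.
have [[t ti] _] := FG; have [s [st ts]] := ti b.
exists (s \c (fmap G k \c t a)).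
apply: (quasi_inverse_faithful (quasi_inverse_sym FG)).
apply: (iso_epic (ti a)).
have /= <- := naturality t (s \c (fmap G k \c t a)).
by rewrite compA ts comp1m.
Qed.

Lemma quasi_inverse_reflect_final (a : C) : final (F a) -> final a.
Proof.
move=> fFa b; have [k kP] := fFa (F b); have [f fk] := quasi_inverse_full k.
by exists f => g; apply: (quasi_inverse_faithful FG); rewrite fk; exact: kP.
Qed.

Lemma quasi_inverse_reflect_initial (a : C) : initial (F a) -> initial a.
Proof.
move=> iFa b; have [k kP] := iFa (F b); have [f fk] := quasi_inverse_full k.
by exists f => g; apply: (quasi_inverse_faithful FG); rewrite fk; exact: kP.
Qed.

(** Cones with apex [x] correspond to cones with apex [F (G x)], which
    fullness lifts to cones in the source category. *)
Lemma quasi_inverse_product (a b p : C) (pa : hom p a) (pb : hom p b) :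
  is_product pa pb -> is_product (fmap F pa) (fmap F pb).
Proof.
move=> prod x f g; have [_ [t ti]] := FG; have [s [st ts]] := ti x.
have [f' f'E] := quasi_inverse_full (f \c t x).
have [g' g'E] := quasi_inverse_full (g \c t x).
have [k [[pak pbk] k_uniq]] := prod _ f' g'.
exists (fmap F k \c s); split=> [|l [lf lg]].
  by rewrite !compA -!fmapM pak pbk f'E g'E -!compA ts !compm1.
have [l' l'E] := quasi_inverse_full (l \c t x).
have -> : k = l'.
  apply: k_uniq; split; apply: (quasi_inverse_faithful FG).
    by rewrite fmapM l'E compA lf f'E.
  by rewrite fmapM l'E compA lg g'E.
by rewrite l'E -compA ts compm1.
Qed.

End Equivalence.

Lemma quasi_inverse_irreducible (C D : category) (F : functor C D)
    (G : functor D C) (x : D) :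
  quasi_inverse F G -> irreducible x -> irreducible (G x).
Proof.
move=> FG irr a b p pa pb prod Gxp.
have xFp : isomorphic x (F p).
  apply: isomorphic_trans (isomorphic_fmap F Gxp); apply: isomorphic_sym.
  by have [_ [t ti]] := FG; exists (t x); exact: ti.
have [Fa|Fb] := irr _ _ _ _ _ (quasi_inverse_product FG prod) xFp.
  by left; exact: (quasi_inverse_reflect_final FG Fa).
by right; exact: (quasi_inverse_reflect_final FG Fb).
Qed.

End Categories.

(** * Effect algebras through their order and difference *)

Section EffectAlgebraTheory.
Variable E : effect_algebra.
Implicit Types (a b c d : E) (u : nat -> E).

Lemma oplus0x a : oplus ea0 a = Some a.
Proof. exact/oplusC/oplus0. Qed.

Lemma ea_le_oplus a b c : oplus a b = Some c -> ea_le a c.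
Proof. by exists b. Qed.

Lemma ea_le0 a : ea_le a ea0 -> a = ea0.
Proof. by move=> a0; apply: ea_le_anti a0 _; exact: ea_ge0. Qed.

Lemma orthK a : orth (orth a) = a.
Proof. by symmetry; apply: orth_unique; exact/oplusC/oplus_orth. Qed.

Lemma orth1 : orth ea1 = ea0 :> E.
Proof. by rewrite orthK. Qed.

(** The difference operation of D-posets. Unlike the domain of [oplus], its
    domain, the pairs with [a <= b], can be read off the order. *)
Definition ediff b a : E := xget ea0 [set c | oplus a c = Some b].

Lemma oplus_ediff a b : ea_le a b -> oplus a (ediff b a) = Some b.
Proof.
by move=> [c ac]; rewrite /ediff; case: xgetP => [x _ xP|/(_ c)[]].
Qed.

Lemma ediff_oplus a b c : oplus a c = Some b -> ediff b a = c.
Proof.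
by move=> ac; apply: (oplus_cancel (oplus_ediff _) ac); exists c.
Qed.

Lemma ediff1x a : ediff ea1 a = orth a.
Proof. exact/ediff_oplus/oplus_orth. Qed.

Lemma ediffxx a : ediff a a = ea0.
Proof. exact/ediff_oplus/oplus0. Qed.

Lemma ediff_le a b : ea_le (ediff b a) b.
Proof.
rewrite /ediff; case: xgetP => [c _ abc|_]; last exact: ea_ge0.
by exists a; exact: oplusC.
Qed.

Lemma ediffK a b : ea_le a b -> ediff b (ediff b a) = a.
Proof. by move=> /oplus_ediff/oplusC/ediff_oplus. Qed.

Lemma oplus_ediff_trans a b c : ea_le a b -> ea_le b c ->
  oplus (ediff b a) (ediff c b) = Some (ediff c a).
Proof.
move=> /oplus_ediff ab /oplus_ediff bc; have [d -> ad] := oplusA ab bc.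
by rewrite (ediff_oplus ad).
Qed.

Lemma ediff_anti a b c : ea_le a b -> ea_le b c ->
  ea_le (ediff c b) (ediff c a).
Proof.
by move=> ab bc; exact: ea_le_oplus (oplusC (oplus_ediff_trans ab bc)).
Qed.

Lemma ediff_ediff a b c : ea_le a b -> ea_le b c ->
  ediff (ediff c a) (ediff c b) = ediff b a.
Proof.
by move=> ab bc; exact: ediff_oplus (oplusC (oplus_ediff_trans ab bc)).
Qed.

Lemma orth_anti a b : ea_le a b -> ea_le (orth b) (orth a).
Proof.
by move=> ab; rewrite -!ediff1x; apply: ediff_anti; last exact: ea_le1.
Qed.

(** Increasing sequences and suprema in terms of [ea_le], which spares the
    passage to the poset of an effect algebra. *)
Definition incr u := forall n, ea_le (u n) (u n.+1).

Definition is_sup u s :=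
  (forall n, ea_le (u n) s) /\ forall y, (forall n, ea_le (u n) y) -> ea_le s y.

Lemma incr_homo u : incr u -> forall m n, (m <= n)%N -> ea_le (u m) (u n).
Proof.
move=> u_incr m n /subnK <-; elim: (n - m)%N => [|k IH]; first exact: ea_le_refl.
by rewrite addSn; exact: ea_le_trans IH (u_incr _).
Qed.

Lemma incrP u :
  incr u <-> {homo (u : nat -> ea_bposet E) : m n / (m <= n)%N >-> (m <= n)%O}.
Proof.
split=> [/incr_homo u_homo m n /u_homo ?|u_homo n]; first exact/ea_bposet_leP.
exact/ea_bposet_leP/u_homo.
Qed.

Lemma is_supP u s : is_sup u s <-> supremums (range (u : nat -> ea_bposet E)) s.
Proof.
split=> [[us su]|[us su]]; split.
- by move=> _ [n _ <-]; apply/ea_bposet_leP; exact: us.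
- move=> y uy; apply/ea_bposet_leP/su => n; apply/ea_bposet_leP.
  by apply: uy; exists n.
- by move=> n; apply/ea_bposet_leP; apply: us; exists n.
- move=> y uy; apply/ea_bposet_leP/su => _ [n _ <-].
  by apply/ea_bposet_leP; exact: uy.
Qed.

Lemma is_sup_unique u s t : is_sup u s -> is_sup u t -> s = t.
Proof. by move=> [us su] [ut tu]; apply: ea_le_anti; [exact: su|exact: tu]. Qed.

Definition esup u : E := xget ea0 (is_sup u).

End EffectAlgebraTheory.

Lemma ea_hom_le (E F : effect_algebra) (f : ea_hom E F) a b :
  ea_le a b -> ea_le (f a) (f b).
Proof. by move=> [c /(ea_homD f) abc]; exists (f c). Qed.

Lemma ea_hom_ediff (E F : effect_algebra) (f : ea_hom E F) a b :
  ea_le a b -> f (ediff b a) = ediff (f b) (f a).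
Proof. by move=> /oplus_ediff/(ea_homD f)/ediff_oplus ->. Qed.

Lemma ea_hom_orth (E F : effect_algebra) (f : ea_hom E F) a :
  f (orth a) = orth (f a).
Proof. by rewrite -!ediff1x ea_hom_ediff ?ea_hom1//; exact: ea_le1. Qed.

Lemma ea_hom0 (E F : effect_algebra) (f : ea_hom E F) : f ea0 = ea0.
Proof. by rewrite -!orth1 ea_hom_orth ea_hom1. Qed.

Lemma esupP (M : omega_effect_monoid) (u : nat -> M) :
  incr u -> is_sup u (esup u).
Proof.
move=> /incrP/(@oem_complete M u)[s /is_supP us].
by rewrite /esup; case: xgetP => [//|/(_ s)[]].
Qed.

Lemma oem_hom_sup (M N : omega_effect_monoid) (f : oem_hom M N)
    (u : nat -> M) s : incr u -> is_sup u s -> is_sup (f \o u) (f s).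
Proof. by move=> /incrP ui /is_supP us; apply/is_supP; exact: oem_normal. Qed.

Section EffectMonoidTheory.
Variable M : effect_monoid.
Implicit Types x y z : M.

Lemma emul_ler x y z : ea_le y z -> ea_le (emul x y) (emul x z).
Proof. by move=> [w yz]; exists (emul x w); exact: emulDr. Qed.

Lemma emul_lel x y z : ea_le y z -> ea_le (emul y x) (emul z x).
Proof. by move=> [w yz]; exists (emul w x); exact: emulDl. Qed.

Lemma emul_ediffr x y z : ea_le y z ->
  emul x (ediff z y) = ediff (emul x z) (emul x y).
Proof. by move=> yz; rewrite (ediff_oplus (emulDr x (oplus_ediff yz))). Qed.

Lemma emul_ediffl x y z : ea_le y z ->
  emul (ediff z y) x = ediff (emul z x) (emul y x).
Proof. by move=> yz; rewrite (ediff_oplus (emulDl x (oplus_ediff yz))). Qed.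

End EffectMonoidTheory.

(** Presentation of omega-effect monoids in the style of D-posets. All the
    partial operations are defined on chains of the order, which is what
    makes the structure algebraic over bounded posets. *)
Record dmonoid (K : choiceType) := DMonoid {
  dle : K -> K -> Prop;
  d0 : K;
  d1 : K;
  ddiff : K -> K -> K;
  dmul : K -> K -> K;
  dle_refl : forall a, dle a a;
  dle_trans : forall a b c, dle a b -> dle b c -> dle a c;
  dle_anti : forall a b, dle a b -> dle b a -> a = b;
  dle0x : forall a, dle d0 a;
  dlex1 : forall a, dle a d1;
  ddiff_le : forall a b, dle a b -> dle (ddiff b a) b;
  ddiffK : forall a b, dle a b -> ddiff b (ddiff b a) = a;
  ddiff_anti : forall a b c, dle a b -> dle b c -> dle (ddiff c b) (ddiff c a);
  ddiff_ddiff : forall a b c, dle a b -> dle b c ->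
    ddiff (ddiff c a) (ddiff c b) = ddiff b a;
  dmulA : forall a b c, dmul a (dmul b c) = dmul (dmul a b) c;
  dmulx1 : forall a, dmul a d1 = a;
  dmul1x : forall a, dmul d1 a = a;
  dmul_ler : forall a b c, dle b c -> dle (dmul a b) (dmul a c);
  dmul_lel : forall a b c, dle b c -> dle (dmul b a) (dmul c a);
  dmul_ddiffr : forall a b c, dle b c ->
    dmul a (ddiff c b) = ddiff (dmul a c) (dmul a b);
  dmul_ddiffl : forall a b c, dle b c ->
    dmul (ddiff c b) a = ddiff (dmul c a) (dmul b a);
  dcomplete : forall u : nat -> K, (forall n, dle (u n) (u n.+1)) ->
    exists s, (forall n, dle (u n) s) /\
      forall y, (forall n, dle (u n) y) -> dle s y
}.

Section OmegaEffectMonoidOfDMonoid.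
Variables (K : choiceType) (D : dmonoid K).
Local Notation le := (dle D).
Local Notation diff := (ddiff D).
Local Notation d0 := (d0 D).
Local Notation d1 := (d1 D).

Let diffaa a : diff a a = d0.
Proof.
have da := ddiff_le (dle0x D a).
have := ddiff_anti da (dle_refl D a).
by rewrite (ddiffK (dle0x D a)) => /dle_anti; apply; exact: dle0x.
Qed.

Definition doplus a b : option K :=
  if pselect (le b (diff d1 a)) then Some (diff d1 (diff (diff d1 a) b))
  else None.

(** With [oplus a b = c] expressed as [a <= c] and [c - a = b], the axioms
    of an effect algebra become those of a D-poset. *)
Lemma doplusP a b c : doplus a b = Some c <-> le a c /\ diff c a = b.
Proof.
have a1 := dlex1 D a; have c1 := dlex1 D c.
rewrite /doplus; case: pselect => [ba|ba] /=; split.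
- move=> [<-]; have e := ddiff_le ba; have a'1 := ddiff_le a1.
  have := ddiff_anti e a'1; have := ddiff_ddiff e a'1.
  by rewrite (ddiffK a1) (ddiffK ba).
- by move=> [ac <-]; rewrite -(ddiff_ddiff ac c1) !ddiffK//; exact: ddiff_anti.
- by [].
- by move=> [ac cb]; case: ba; rewrite -cb -(ddiff_ddiff ac c1);
    apply: ddiff_le; exact: ddiff_anti.
Qed.

Program Definition dmonoid_ea : effect_algebra :=
  @EffectAlgebra K d0 doplus (diff d1) _ _ _ _ _ _.
Next Obligation.
move=> a b c /doplusP[ac <-]; apply/doplusP; split; first exact: ddiff_le.
exact: ddiffK.
Qed.
Next Obligation. by move=> a; apply/doplusP; split; [exact: dle_refl|]. Qed.
Next Obligation.
move=> a b c ab abc /doplusP[a_ab <-] /doplusP[ab_abc <-].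
exists (diff abc a); apply/doplusP; last by split; [exact: dle_trans ab_abc|].
split; last by rewrite -(ddiff_ddiff a_ab ab_abc) ddiffK//; exact: ddiff_anti.
by rewrite -(ddiff_ddiff a_ab ab_abc); apply: ddiff_le; exact: ddiff_anti.
Qed.
Next Obligation.
move=> a; apply/doplusP; rewrite -(diffaa d1) (ddiffK (dle_refl D d1)).
by split; first exact: dlex1.
Qed.
Next Obligation.
by move=> a b; rewrite -(diffaa d1) (ddiffK (dle_refl D d1)) => /doplusP[].
Qed.
Next Obligation.
move=> a b; rewrite -(diffaa d1) (ddiffK (dle_refl D d1)) => /doplusP[ab ba].
have b1 : b = d1.
  by apply: (@dle_anti _ D); [exact: dlex1|rewrite -ba; exact: ddiff_le].
by rewrite -(ddiffK ab) ba b1 diffaa.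
Qed.

Lemma dmonoid_leP a b : @ea_le dmonoid_ea a b <-> le a b.
Proof.
by split=> [[c /doplusP[]]//|ab]; exists (diff b a); exact/doplusP.
Qed.

Lemma dmonoid_ediff a b : le a b -> @ediff dmonoid_ea b a = diff b a.
Proof. by move=> ab; apply: ediff_oplus; exact/doplusP. Qed.

Lemma dmonoid_ea1 : ea1 = d1 :> dmonoid_ea.
Proof. by rewrite /ea1 /= -(diffaa d1) (ddiffK (dle_refl D d1)). Qed.

Program Definition dmonoid_em : effect_monoid :=
  @EffectMonoid dmonoid_ea (dmul D) _ _ _ _ _.
Next Obligation. by move=> a b c; exact: dmulA. Qed.
Next Obligation. by move=> a; rewrite dmonoid_ea1; exact: dmulx1. Qed.
Next Obligation. by move=> a; rewrite dmonoid_ea1; exact: dmul1x. Qed.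
Next Obligation.
move=> a b c d /doplusP[bd <-]; apply/doplusP; split; first exact: dmul_ler.
by rewrite dmul_ddiffr.
Qed.
Next Obligation.
move=> a b c d /doplusP[bd <-]; apply/doplusP; split; first exact: dmul_lel.
by rewrite dmul_ddiffl.
Qed.

Lemma dmonoid_complete : omega_complete (ea_bposet dmonoid_em).
Proof.
move=> u /incrP u_incr.
have [n|s [us su]] := @dcomplete _ D u; first exact/dmonoid_leP/u_incr.
exists s; apply/is_supP; split=> [n|y uy]; apply/dmonoid_leP => //.
by apply: su => n; exact/dmonoid_leP.
Qed.

Definition dmonoid_oem := OmegaEffectMonoid dmonoid_complete.

End OmegaEffectMonoidOfDMonoid.

(** Homomorphisms seen through the D-poset presentation, in which most of
    the structures below are given. *)
Section HomBuilder.
Variables (M N : omega_effect_monoid) (f : M -> N).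
Hypothesis f1 : f ea1 = ea1.
Hypothesis f_le : forall a b, ea_le a b -> ea_le (f a) (f b).
Hypothesis f_ediff : forall a b, ea_le a b -> f (ediff b a) = ediff (f b) (f a).
Hypothesis f_mul : forall a b, f (emul a b) = emul (f a) (f b).
Hypothesis f_sup : forall u s, incr u -> is_sup u s -> is_sup (f \o u) (f s).

Program Definition mk_oem_hom : oem_hom M N :=
  @OEMHom M N (@EAHom M N f f1 _) _ f_mul.
Next Obligation.
move=> a b c abc; rewrite -{}(ediff_oplus abc).
have ac := ea_le_oplus abc; rewrite f_ediff//.
exact: oplus_ediff (f_le ac).
Qed.
Next Obligation. by move=> u s /incrP ui /is_supP us; apply/is_supP/f_sup. Qed.

End HomBuilder.

Lemma oem_hom_ext (M N : omega_effect_monoid) (f g : oem_hom M N) :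
  (forall x, f x = g x) -> f = g.
Proof. by move=> fg; apply: oem_hom_eq; exact/funext. Qed.

(** A subset [K] of a product of omega-effect monoids that is closed under
    the operations. The index type may be large, in which case the full
    product lives in too high a universe to be an omega-effect monoid: this
    is how the family of all models yields a free object. *)
Section Subproduct.
Variables (K : choiceType) (I : Type) (M : I -> omega_effect_monoid).
Variables (v : forall i, K -> M i) (k0 k1 : K) (diff mul : K -> K -> K).
Hypothesis v_inj : forall x y, (forall i, v i x = v i y) -> x = y.
Hypothesis v0 : forall i, v i k0 = ea0.
Hypothesis v1 : forall i, v i k1 = ea1.
Hypothesis v_diff : forall x y, (forall i, ea_le (v i x) (v i y)) ->
  forall i, v i (diff y x) = ediff (v i y) (v i x).
Hypothesis v_mul : forall x y i, v i (mul x y) = emul (v i x) (v i y).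
Hypothesis v_sup : forall u : nat -> K, (forall i, incr (v i \o u)) ->
  exists s, forall i, is_sup (v i \o u) (v i s).

Program Definition subproduct : dmonoid K :=
  @DMonoid K (fun x y => forall i, ea_le (v i x) (v i y)) k0 k1 diff mul
    _ _ _ _ _ _ _ _ _ _ _ _ _ _ _ _ _.
Next Obligation. by move=> a i; exact: ea_le_refl. Qed.
Next Obligation. by move=> a b c ab bc i; exact: ea_le_trans (bc i). Qed.
Next Obligation. by move=> a b ab ba; apply: v_inj => i; exact: ea_le_anti. Qed.
Next Obligation. by move=> a i; rewrite v0; exact: ea_ge0. Qed.
Next Obligation. by move=> a i; rewrite v1; exact: ea_le1. Qed.
Next Obligation. by move=> a b ab i; rewrite v_diff//; exact: ediff_le. Qed.
Next Obligation.
move=> a b ab; apply: v_inj => i.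
by rewrite !v_diff ?ediffK// => j; rewrite v_diff//; exact: ediff_le.
Qed.
Next Obligation.
move=> a b c ab bc i; have ac j := ea_le_trans (ab j) (bc j).
by rewrite !v_diff//; exact: ediff_anti.
Qed.
Next Obligation.
move=> a b c ab bc; have ac j := ea_le_trans (ab j) (bc j).
apply: v_inj => i; rewrite !v_diff ?ediff_ediff// => j.
by rewrite !v_diff//; exact: ediff_anti.
Qed.
Next Obligation. by move=> a b c; apply: v_inj => i; rewrite !v_mul emulA. Qed.
Next Obligation. by move=> a; apply: v_inj => i; rewrite v_mul v1 emulx1. Qed.
Next Obligation. by move=> a; apply: v_inj => i; rewrite v_mul v1 emul1x. Qed.
Next Obligation. by move=> a b c bc i; rewrite !v_mul; exact: emul_ler. Qed.
Next Obligation. by move=> a b c bc i; rewrite !v_mul; exact: emul_lel. Qed.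
Next Obligation.
move=> a b c bc; apply: v_inj => i; rewrite v_mul !v_diff ?v_mul ?emul_ediffr//.
by move=> j; rewrite !v_mul; exact: emul_ler.
Qed.
Next Obligation.
move=> a b c bc; apply: v_inj => i; rewrite v_mul !v_diff ?v_mul ?emul_ediffl//.
by move=> j; rewrite !v_mul; exact: emul_lel.
Qed.
Next Obligation.
move=> u u_incr; have [//|s us] := @v_sup u; first by move=> i n; exact: u_incr.
exists s; split=> [n i|y uy i]; first exact: (us i).1.
by apply: (us i).2 => n; exact: uy.
Qed.

Local Notation S := (dmonoid_oem subproduct).

Program Definition subproduct_proj i : oem_hom S (M i) :=
  @mk_oem_hom S (M i) (v i) _ _ _ _ _.
Next Obligation. by move=> i; rewrite dmonoid_ea1. Qed.
Next Obligation. by move=> i a b /dmonoid_leP. Qed.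
Next Obligation.
by move=> i a b /dmonoid_leP ab; rewrite dmonoid_ediff//= v_diff.
Qed.
Next Obligation. by move=> i a b /=; rewrite v_mul. Qed.
Next Obligation.
move=> i u s u_incr us.
have [|t ut] := @v_sup u; first by move=> j n; have /dmonoid_leP/(_ j) := u_incr n.
suff -> : s = t by [].
apply: (@is_sup_unique S u) => //; split=> [n|y uy]; apply/dmonoid_leP => j.
  exact: (ut j).1.
by apply: (ut j).2 => n; have /dmonoid_leP/(_ j) := uy n.
Qed.

End Subproduct.

(** * The free omega-effect monoid on a bounded poset *)

(** Formal expressions for the elements of the free omega-effect monoid. The
    constants [0] and [1] are the generators at the bounds of the poset. *)
Inductive term (X : Type) :=
| Gen of X
| Diff of term X & term X
| Mul of term X & term X
| Sup of nat -> term X.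

HB.instance Definition _ (X : Type) := gen_eqMixin (term X).
HB.instance Definition _ (X : Type) := gen_choiceMixin (term X).

Record universal_arrow (X : bposet) := UniversalArrow {
  universal_oem : omega_effect_monoid;
  universal_gen : bposet_hom X (ea_bposet universal_oem);
  universal_lift : forall M : omega_effect_monoid,
    bposet_hom X (ea_bposet M) -> oem_hom universal_oem M;
  universal_lift_gen : forall (M : omega_effect_monoid)
      (f : bposet_hom X (ea_bposet M)) x,
    universal_lift f (universal_gen x) = f x;
  universal_hom_ext : forall (M : omega_effect_monoid)
      (f g : oem_hom universal_oem M),
    (forall x, f (universal_gen x) = g (universal_gen x)) -> f = g
}.

Section Free.
Variable X : bposet.
Implicit Types t s : term X.

Definition model := {M : omega_effect_monoid & bposet_hom X (ea_bposet M)}.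
Definition model_oem (i : model) : omega_effect_monoid := projT1 i.
Coercion model_oem : model >-> omega_effect_monoid.

Fixpoint eval (i : model) t : i :=
  match t with
  | Gen x => projT2 i x
  | Diff t s => ediff (eval i t) (eval i s)
  | Mul t s => emul (eval i t) (eval i s)
  | Sup u => esup (fun n => eval i (u n))
  end.

(** Only the operations that are meaningful in every model are kept. The
    quantification over all models is impredicative, so that it does not
    raise the universe of the terms. *)
Fixpoint wf t : Prop :=
  match t with
  | Gen x => True
  | Diff t s => [/\ wf t, wf s & forall i, ea_le (eval i s) (eval i t)]
  | Mul t s => wf t /\ wf s
  | Sup u => (forall n, wf (u n)) /\ forall i, incr (fun n => eval i (u n))
  end.

Definition wf_term : Type := {t : term X | `[<wf t>]}.
HB.instance Definition _ := Choice.on wf_term.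

Definition eqeval (t s : wf_term) : bool :=
  `[<forall i, eval i (val t) = eval i (val s)>].

Lemma eqeval_equiv : equiv_class_of eqeval.
Proof.
split=> [t|t s|t s r]; first exact/asboolP.
  by apply/asboolP/asboolP => ts i.
by move=> /asboolP ts /asboolP tr; apply/asboolP => i; rewrite ts.
Qed.
Canonical eqeval_equivRel := EquivRelPack eqeval_equiv.

Definition term_class : Type := {eq_quot eqeval}.
HB.instance Definition _ := Choice.on term_class.
HB.instance Definition _ := EqQuotient.on term_class.

Definition value (i : model) (x : term_class) : i := eval i (val (repr x)).

Lemma value_inj x y : (forall i, value i x = value i y) -> x = y.
Proof. by move=> xy; rewrite -[x]reprK -[y]reprK; apply/eqmodP/asboolP. Qed.

Definition class t (w : wf t) : term_class :=
  \pi_({eq_quot eqeval}) (exist _ t (asboolT w) : wf_term).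

Lemma value_class i t (w : wf t) : value i (class w) = eval i t.
Proof.
rewrite /value /class; case: piP => s /eqmodP/asboolP /(_ i) /= <-.
by [].
Qed.

Lemma wf_repr (x : term_class) : wf (val (repr x)).
Proof. exact: (asboolW (valP (repr x))). Qed.

Definition class_gen (x : X) : term_class := @class (Gen x) I.

Definition class_diff (x y : term_class) : term_class :=
  if pselect (wf (Diff (val (repr x)) (val (repr y)))) is left w then class w
  else x.

Definition class_mul (x y : term_class) : term_class :=
  @class (Mul (val (repr x)) (val (repr y))) (conj (wf_repr x) (wf_repr y)).

Lemma value_gen i x : value i (class_gen x) = projT2 i x.
Proof. exact: value_class. Qed.

Lemma value_diff x y : (forall i, ea_le (value i x) (value i y)) ->
  forall i, value i (class_diff y x) = ediff (value i y) (value i x).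
Proof.
move=> xy i; rewrite /class_diff; case: pselect => [w|[]].
  exact: value_class.
by split; [exact: wf_repr|exact: wf_repr|].
Qed.

Lemma value_mul x y i : value i (class_mul x y) = emul (value i x) (value i y).
Proof. exact: value_class. Qed.

Lemma value_sup (u : nat -> term_class) : (forall i, incr (value i \o u)) ->
  exists s : term_class, forall i, is_sup (value i \o u) (value i s).
Proof.
move=> u_incr; have w : wf (Sup (fun n => val (repr (u n)))).
  by split=> [n|//]; exact: wf_repr.
by exists (class w) => i; rewrite value_class; exact: esupP (u_incr i).
Qed.

Lemma value0 i : value i (class_gen \bot%O) = ea0.
Proof. by rewrite value_gen bposet_hom0. Qed.

Lemma value1 i : value i (class_gen \top%O) = ea1.
Proof. by rewrite value_gen bposet_hom1. Qed.

Definition term_oem : omega_effect_monoid :=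
  dmonoid_oem (subproduct value_inj value0 value1 value_diff value_mul value_sup).

Program Definition term_gen : bposet_hom X (ea_bposet term_oem) :=
  @BPosetHom X (ea_bposet term_oem) class_gen _ _ _.
Next Obligation.
move=> x y xy; apply/ea_bposet_leP/dmonoid_leP => i.
by rewrite !value_gen; exact/ea_bposet_leP/bposet_homo.
Qed.
Next Obligation. by []. Qed.
Next Obligation. by symmetry; exact: dmonoid_ea1. Qed.

Definition term_lift (M : omega_effect_monoid) (f : bposet_hom X (ea_bposet M)) :
    oem_hom term_oem M :=
  subproduct_proj value_inj value0 value1 value_diff value_mul value_sup
    (existT _ M f).

Lemma term_lift_gen (M : omega_effect_monoid) (f : bposet_hom X (ea_bposet M)) x :
  term_lift f (term_gen x) = f x.
Proof. exact: (@value_gen (existT _ M f)). Qed.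

Lemma value_le (x y : term_oem) :
  ea_le x y <-> forall i, ea_le (value i x) (value i y).
Proof. exact: dmonoid_leP. Qed.

(** Induction on well-formed terms: each of their operations is a genuine
    operation of the free object, so a homomorphism must preserve it. *)
Lemma term_hom_ext (M : omega_effect_monoid) (f g : oem_hom term_oem M) :
  (forall x, f (term_gen x) = g (term_gen x)) -> f = g.
Proof.
move=> fg; apply: oem_hom_ext => x.
suff {x}H t (w : wf t) : f (class w) = g (class w).
  rewrite (_ : x = class (wf_repr x)) ?H//.
  by apply: value_inj => i; rewrite value_class.
elim: t w => [x|t IHt s IHs|t IHt s IHs|u IHu] w.
- rewrite (_ : class w = term_gen x)//.
  by apply: value_inj => i; rewrite !value_class.
- have [wt ws st] := w.
  have cst : @ea_le term_oem (class ws) (class wt).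
    by apply/value_le => i; rewrite !value_class.
  have -> : class w = @ediff term_oem (class wt) (class ws).
    rewrite dmonoid_ediff; last exact/dmonoid_leP.
    by apply: value_inj => i; rewrite /= value_diff ?value_class// => j;
      rewrite !value_class.
  by rewrite !ea_hom_ediff// IHt IHs.
- have [wt ws] := w.
  have -> : class w = @emul term_oem (class wt) (class ws).
    by apply: value_inj => i; rewrite value_mul !value_class.
  by rewrite !oem_homM IHt IHs.
- have [wu ui] := w; pose U n : term_oem := class (wu n).
  have Ui : incr U by move=> n; apply/value_le => i; rewrite !value_class; exact: ui.
  have Us : is_sup U (class w : term_oem).
    split=> [n|y Uy]; apply/value_le => i.
      by rewrite !value_class; exact: (esupP (ui i)).1.
    rewrite value_class; apply: (esupP (ui i)).2 => n.
    by have /value_le/(_ i) := Uy n; rewrite value_class.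
  apply: (is_sup_unique (oem_hom_sup f Ui Us)).
  have -> : f \o U = g \o U by apply/funext => n; exact: IHu.
  exact: oem_hom_sup.
Qed.

End Free.

(** Opaque, so that computation does not unfold the quotient of terms: only
    the universal property is used. *)
Lemma free_construction (X : bposet) : universal_arrow X.
Proof. exact: UniversalArrow (@term_lift_gen X) (@term_hom_ext X). Qed.

Definition free_oem (X : bposet) : omega_effect_monoid :=
  universal_oem (free_construction X).
Definition gen (X : bposet) : bposet_hom X (ea_bposet (free_oem X)) :=
  universal_gen (free_construction X).
Definition free_lift (X : bposet) (M : omega_effect_monoid)
    (f : bposet_hom X (ea_bposet M)) : oem_hom (free_oem X) M :=
  universal_lift (free_construction X) f.

Lemma free_lift_gen (X : bposet) (M : omega_effect_monoid)
    (f : bposet_hom X (ea_bposet M)) x : free_lift f (gen X x) = f x.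
Proof. exact: universal_lift_gen. Qed.

Lemma free_hom_ext (X : bposet) (M : omega_effect_monoid)
    (f g : oem_hom (free_oem X) M) :
  (forall x, f (gen X x) = g (gen X x)) -> f = g.
Proof. exact: universal_hom_ext. Qed.

Arguments free_oem : simpl never.
Arguments gen : simpl never.
Arguments free_lift : simpl never.

(** * The monad and the operations on its algebras *)

Lemma bposet_hom_ext (X Y : bposet) (f g : bposet_hom X Y) :
  (forall x, f x = g x) -> f = g.
Proof. by move=> fg; apply: bposet_hom_eq; exact/funext. Qed.

(** Reflection of the order transports suprema, which are order-theoretic,
    to the inverse map; the algebraic operations follow by injectivity. *)
Lemma oem_bijective_is_iso (M N : OmegaEM) (f : hom M N) :
  (forall a b : M, ea_le ((f : oem_hom M N) a) ((f : oem_hom M N) b) ->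
    ea_le a b) ->
  (forall y : N, exists x : M, (f : oem_hom M N) x = y) -> is_iso f.
Proof.
move: f => /= f f_le f_surj.
have g_ex y : {x : M | f x = y} by exact/cid.
pose g y := sval (g_ex y); have fg y : f (g y) = y by exact: svalP (g_ex y).
have f_inj a b : f a = f b -> a = b.
  by move=> ab; apply: ea_le_anti; apply: f_le; rewrite ab; exact: ea_le_refl.
have gf x : g (f x) = x by exact: f_inj.
have g_le a b : ea_le a b -> ea_le (g a) (g b).
  by move=> ab; apply: f_le; rewrite !fg.
have g1 : g ea1 = ea1 by rewrite -(ea_hom1 f).
have g_ediff a b : ea_le a b -> g (ediff b a) = ediff (g b) (g a).
  by move=> ab; apply: f_inj; rewrite ea_hom_ediff ?fg//; exact: g_le.
have gM a b : g (emul a b) = emul (g a) (g b).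
  by apply: f_inj; rewrite oem_homM !fg.
have g_sup (u : nat -> N) s : incr u -> is_sup u s -> is_sup (g \o u) (g s).
  move=> _ [us su]; split=> [n|y uy]; first exact/g_le/us.
  apply: f_le; rewrite fg; apply: su => n; rewrite -(fg (u n)).
  exact/ea_hom_le/uy.
exists (mk_oem_hom g1 g_le g_ediff gM g_sup).
by split; apply: oem_hom_ext => x /=; [exact: gf|exact: fg].
Qed.

Program Definition forget : functor OmegaEM BPos :=
  @Functor OmegaEM BPos (fun M : omega_effect_monoid => ea_bposet M)
    (fun (M N : omega_effect_monoid) (f : oem_hom M N) =>
      @BPosetHom (ea_bposet M) (ea_bposet N) f _ (ea_hom0 f) (ea_hom1 f)) _ _.
Next Obligation.
by move=> M N f x y /ea_bposet_leP xy; apply/ea_bposet_leP; exact: ea_hom_le.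
Qed.
Next Obligation. by move=> M; exact: bposet_hom_ext. Qed.
Next Obligation. by move=> M N P g f; exact: bposet_hom_ext. Qed.

Program Definition free_functor : functor BPos OmegaEM :=
  @Functor BPos OmegaEM free_oem
    (fun (X Y : bposet) (f : bposet_hom X Y) => free_lift (bposet_comp (gen Y) f)) _ _.
Next Obligation.
by move=> X; apply: free_hom_ext => x /=; rewrite free_lift_gen.
Qed.
Next Obligation.
by move=> X Y Z g f; apply: free_hom_ext => x /=; rewrite !free_lift_gen.
Qed.

Definition counit (M : omega_effect_monoid) :
    oem_hom (free_oem (ea_bposet M)) M :=
  free_lift (bposet_id (ea_bposet M)).

Arguments counit : simpl never.

Lemma counit_gen (M : omega_effect_monoid) (x : M) :
  counit M (gen (ea_bposet M) x) = x.
Proof. exact: free_lift_gen. Qed.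

Program Definition free_monad : monad BPos :=
  @Monad BPos (functor_comp forget free_functor)
    (@Nattrans BPos BPos (functor_id BPos) (functor_comp forget free_functor)
      gen _)
    (@Nattrans BPos BPos
      (functor_comp (functor_comp forget free_functor)
        (functor_comp forget free_functor))
      (functor_comp forget free_functor)
      (fun X : bposet => fmap forget (counit (free_oem X) : @hom OmegaEM _ _)) _)
    _ _ _.
Next Obligation.
by move=> X Y f; apply: bposet_hom_ext => x /=; rewrite free_lift_gen.
Qed.
Next Obligation.
move=> X Y f; rewrite -[LHS](fmapM forget) -[RHS](fmapM forget); congr (fmap forget).
by apply: free_hom_ext => x; rewrite /= free_lift_gen counit_gen counit_gen.
Qed.
Next Obligation. by move=> X; apply: bposet_hom_ext => x /=; rewrite counit_gen. Qed.
Next Obligation.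
move=> X; rewrite -[LHS](fmapM forget) -[RHS](fmap1 forget); congr (fmap forget).
by apply: free_hom_ext => x; rewrite /= free_lift_gen counit_gen.
Qed.
Next Obligation.
move=> X; rewrite -[LHS](fmapM forget) -[RHS](fmapM forget); congr (fmap forget).
by apply: free_hom_ext => x; rewrite /= free_lift_gen !counit_gen.
Qed.

Section AlgebraStructure.
Variable A : algebra free_monad.
Local Notation X := (alg_ob A : bposet).
Local Notation alpha := (alg_str A : bposet_hom (ea_bposet (free_oem X)) X).
Local Notation Talpha :=
  (fmap free_functor (alg_str A) :
    oem_hom (free_oem (ea_bposet (free_oem X))) (free_oem X)).
Implicit Types (x y z : X) (p q : free_oem X).

Let g (x : X) : free_oem X := gen X x.

Lemma alg_str_gen x : alpha (g x) = x.
Proof. exact: (congr1 (fun f : bposet_hom X X => f x) (alg_unit A)). Qed.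

Lemma alg_str_counit (p : free_oem (ea_bposet (free_oem X))) :
  alpha (counit (free_oem X) p) = alpha (Talpha p).
Proof.
exact: (congr1
  (fun f : bposet_hom (ea_bposet (free_oem (ea_bposet (free_oem X)))) X =>
  f p) (alg_mult A)).
Qed.

Lemma alg_str_le p q : ea_le p q -> (alpha p <= alpha q)%O.
Proof. by move=> pq; apply: bposet_homo; exact/ea_bposet_leP. Qed.

Lemma gen_le (Y : bposet) (x y : Y) :
  (x <= y)%O -> ea_le (gen Y x : free_oem Y) (gen Y y).
Proof. by move=> xy; exact/ea_bposet_leP/bposet_homo. Qed.

(** Operations on the algebra: operate formally on generators, then
    evaluate. Since [gen] is monotone, the formal operation is meaningful
    whenever the operation on elements should be. *)
Definition alg_diff y x : X := alpha (ediff (g y) (g x)).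
Definition alg_mul x y : X := alpha (emul (g x) (g y)).
Definition alg_sup (u : nat -> X) : X := alpha (esup (g \o u)).

Let G (p : free_oem X) : free_oem (ea_bposet (free_oem X)) :=
  gen (ea_bposet (free_oem X)) p.

Let Talpha_G p : Talpha (G p) = g (alpha p). Proof. exact: free_lift_gen. Qed.

(** The structure map evaluates formal operations: the multiplication law of
    the algebra lets it commute with the operations of the free omega-effect
    monoid. *)
Lemma alg_str_diff p q : ea_le q p ->
  alpha (ediff p q) = alg_diff (alpha p) (alpha q).
Proof.
move=> qp; have Gqp : ea_le (G q) (G p) by apply: gen_le; exact/ea_bposet_leP.
rewrite /alg_diff -!Talpha_G -ea_hom_ediff// -alg_str_counit.
by rewrite ea_hom_ediff// !counit_gen.
Qed.

Lemma alg_str_mul p q : alpha (emul p q) = alg_mul (alpha p) (alpha q).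
Proof.
by rewrite /alg_mul -!Talpha_G -oem_homM -alg_str_counit oem_homM !counit_gen.
Qed.

Lemma alg_str_sup (u : nat -> free_oem X) : incr u ->
  alpha (esup u) = alg_sup (fun n => alpha (u n)).
Proof.
move=> u_incr.
have Gu : incr (G \o u) by move=> n; apply: gen_le; exact/ea_bposet_leP/u_incr.
have Tu : Talpha (esup (G \o u)) = esup (fun n => g (alpha (u n))).
  have := oem_hom_sup Talpha Gu (esupP Gu).
  have -> : Talpha \o (G \o u) = fun n => g (alpha (u n)).
    by apply/funext => n; exact: Talpha_G.
  move/is_sup_unique; apply; apply: esupP => n.
  exact/gen_le/alg_str_le/u_incr.
have -> : alg_sup (fun n => alpha (u n)) = alpha (Talpha (esup (G \o u))).
  by rewrite Tu.
rewrite -alg_str_counit; congr (alpha _).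
have := oem_hom_sup (counit (free_oem X)) Gu (esupP Gu).
have -> : counit (free_oem X) \o (G \o u) = u.
  by apply/funext => n; exact: counit_gen.
by apply: is_sup_unique; exact: esupP.
Qed.

(** A monotone map with a monotone section turns a supremum of generators
    into a supremum: the structure map is one, by the unit law of the
    algebra. *)
Lemma alg_supP (u : nat -> X) : (forall n, (u n <= u n.+1)%O) ->
  (forall n, (u n <= alg_sup u)%O) /\
  (forall y, (forall n, (u n <= y)%O) -> (alg_sup u <= y)%O).
Proof.
move=> u_incr; have [gu ug] : is_sup (g \o u) (esup (g \o u)).
  by apply: esupP => n; exact: gen_le.
split=> [n|y uy]; first by rewrite -[u n]alg_str_gen; exact/alg_str_le/gu.
by rewrite -[y]alg_str_gen; apply/alg_str_le/ug => n; exact: gen_le.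
Qed.

(** The hypotheses of each axiom are inequalities between elements: [gen]
    preserves them, the axiom holds in the free omega-effect monoid, and the
    structure map brings its conclusion back. *)
Program Definition alg_dmonoid : dmonoid X :=
  @DMonoid X (fun x y => (x <= y)%O) \bot%O \top%O alg_diff alg_mul
    _ _ _ _ _ _ _ _ _ _ _ _ _ _ _ _ _.
Next Obligation. by move=> a; exact: Order.le_refl. Qed.
Next Obligation. by move=> a b c; exact: Order.le_trans. Qed.
Next Obligation. by move=> a b ab ba; apply/Order.le_anti/andP. Qed.
Next Obligation. by move=> a; exact: Order.le0x. Qed.
Next Obligation. by move=> a; exact: Order.lex1. Qed.
Next Obligation.
move=> a b /gen_le ab; rewrite -[b in (_ <= b)%O]alg_str_gen.
exact/alg_str_le/ediff_le.
Qed.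
Next Obligation.
move=> a b /gen_le ab; rewrite -[b in alg_diff b _]alg_str_gen.
by rewrite -alg_str_diff ?ediffK ?alg_str_gen//; exact: ediff_le.
Qed.
Next Obligation.
by move=> a b c /gen_le ab /gen_le bc; exact/alg_str_le/ediff_anti.
Qed.
Next Obligation.
move=> a b c /gen_le ab /gen_le bc.
by rewrite -alg_str_diff ?ediff_ediff//; exact: ediff_anti.
Qed.
Next Obligation.
move=> a b c; rewrite -[a in LHS]alg_str_gen -[c in RHS]alg_str_gen.
by rewrite -!alg_str_mul emulA.
Qed.
Next Obligation.
move=> a; rewrite /alg_mul (_ : g \top%O = ea1) ?emulx1 ?alg_str_gen//.
exact: (bposet_hom1 (gen X)).
Qed.
Next Obligation.
move=> a; rewrite /alg_mul (_ : g \top%O = ea1) ?emul1x ?alg_str_gen//.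
exact: (bposet_hom1 (gen X)).
Qed.
Next Obligation. by move=> a b c /gen_le bc; exact/alg_str_le/emul_ler. Qed.
Next Obligation. by move=> a b c /gen_le bc; exact/alg_str_le/emul_lel. Qed.
Next Obligation.
move=> a b c /gen_le bc; rewrite -[a in LHS]alg_str_gen -alg_str_mul.
by rewrite emul_ediffr// alg_str_diff//; exact: emul_ler.
Qed.
Next Obligation.
move=> a b c /gen_le bc; rewrite -[a in LHS]alg_str_gen -alg_str_mul.
by rewrite emul_ediffl// alg_str_diff//; exact: emul_lel.
Qed.
Next Obligation. by move=> u /alg_supP us; exists (alg_sup u). Qed.

Definition alg_oem : omega_effect_monoid := dmonoid_oem alg_dmonoid.

Lemma alg_oem_leP (x y : X) : @ea_le alg_oem x y <-> (x <= y)%O.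
Proof. exact (@dmonoid_leP _ alg_dmonoid x y). Qed.

Lemma alg_oem_ediff (x y : X) :
  (x <= y)%O -> @ediff alg_oem y x = alg_diff y x.
Proof. exact: (@dmonoid_ediff _ alg_dmonoid). Qed.

Lemma alg_oem_is_sup (u : nat -> X) (s : X) :
  (forall n, (u n <= u n.+1)%O) ->
  @is_sup alg_oem u s <-> s = alg_sup u.
Proof.
move=> u_incr; suff us : @is_sup alg_oem u (alg_sup u).
  by split=> [/is_sup_unique/(_ us)|->].
have [us su] := alg_supP u_incr.
split=> [n|y uy]; apply/alg_oem_leP; first exact: us.
by apply: su => n; apply/alg_oem_leP; exact: uy.
Qed.

Program Definition alg_str_hom : oem_hom (free_oem X) alg_oem :=
  @mk_oem_hom (free_oem X) alg_oem alpha _ _ _ alg_str_mul _.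
Next Obligation. by rewrite (dmonoid_ea1 alg_dmonoid); exact: (bposet_hom1 alpha). Qed.
Next Obligation. by move=> p q pq; apply/alg_oem_leP; exact: alg_str_le. Qed.
Next Obligation.
by move=> p q pq; rewrite alg_str_diff// alg_oem_ediff//; exact: alg_str_le.
Qed.
Next Obligation.
move=> u s ui us; apply/alg_oem_is_sup => [n|]; first exact/alg_str_le/ui.
by rewrite (is_sup_unique us (esupP ui)) alg_str_sup.
Qed.

End AlgebraStructure.

(** * Algebras are omega-effect monoids *)

Lemma alg_hom_str (A B : algebra free_monad) (f : algebra_hom A B)
    (p : free_oem (alg_ob A)) :
  (alg_hom f : bposet_hom (alg_ob A) (alg_ob B))
    ((alg_str A : bposet_hom (ea_bposet (free_oem (alg_ob A))) (alg_ob A)) p) =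
  (alg_str B : bposet_hom (ea_bposet (free_oem (alg_ob B))) (alg_ob B))
    ((fmap free_functor (alg_hom f) :
        oem_hom (free_oem (alg_ob A)) (free_oem (alg_ob B))) p).
Proof.
exact: (congr1 (fun h : bposet_hom (ea_bposet (free_oem (alg_ob A)))
  (alg_ob B) => h p) (alg_homP f)).
Qed.

Lemma free_functor_gen (X Y : bposet) (f : bposet_hom X Y) (x : X) :
  (fmap free_functor (f : @hom BPos X Y) : oem_hom (free_oem X) (free_oem Y))
    (gen X x) = gen Y (f x).
Proof. exact: free_lift_gen. Qed.

Section AlgebraHom.
Variables (A B : algebra free_monad) (h : algebra_hom A B).
Local Notation X := (alg_ob A : bposet).
Local Notation Y := (alg_ob B : bposet).
Local Notation f := (alg_hom h : bposet_hom X Y).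
Local Notation Ff :=
  (fmap free_functor (alg_hom h) : oem_hom (free_oem X) (free_oem Y)).

Program Definition alg_oem_map : oem_hom (alg_oem A) (alg_oem B) :=
  @mk_oem_hom (alg_oem A) (alg_oem B) f _ _ _ _ _.
Next Obligation.
rewrite (dmonoid_ea1 (alg_dmonoid A)) (dmonoid_ea1 (alg_dmonoid B)).
exact: (bposet_hom1 f).
Qed.
Next Obligation.
by move=> x y /alg_oem_leP xy; apply/alg_oem_leP; exact: bposet_homo.
Qed.
Next Obligation.
move=> x y /alg_oem_leP xy.
have fxy : (f x <= f y)%O by exact: bposet_homo.
rewrite !alg_oem_ediff// /alg_diff alg_hom_str ea_hom_ediff; last exact: gen_le.
by rewrite !free_functor_gen.
Qed.
Next Obligation.
by move=> x y; rewrite /= /alg_mul alg_hom_str oem_homM !free_functor_gen.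
Qed.
Next Obligation.
move=> u s u_incr.
have ui n : (u n <= u n.+1)%O by exact/alg_oem_leP/u_incr.
move=> /alg_oem_is_sup-/(_ ui) ->; apply/alg_oem_is_sup => [n|].
  exact: bposet_homo.
rewrite /alg_sup alg_hom_str; congr (bposet_fun _ _).
have gu : incr (fun n => gen X (u n) : free_oem X) by move=> n; exact: gen_le.
have := oem_hom_sup Ff gu (esupP gu).
have -> : Ff \o (fun n => gen X (u n)) = (fun n => gen Y (f (u n))).
  by apply/funext => n; exact: free_functor_gen.
move=> /is_sup_unique; apply; apply: esupP => n.
by apply: gen_le; exact: bposet_homo.
Qed.

End AlgebraHom.

Program Definition alg_to_oem : functor (EilenbergMoore free_monad) OmegaEM :=
  @Functor (EilenbergMoore free_monad) OmegaEM alg_oem alg_oem_map _ _.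
Next Obligation. by move=> A; exact: oem_hom_ext. Qed.
Next Obligation. by move=> A B D g f; exact: oem_hom_ext. Qed.

Program Definition oem_alg (M : OmegaEM) : algebra free_monad :=
  @Algebra BPos free_monad (forget M)
    (fmap forget (counit M : @hom OmegaEM _ _)) _ _.
Next Obligation. by move=> M; apply: bposet_hom_ext => x; exact: counit_gen. Qed.
Next Obligation.
move=> M; rewrite -[LHS](fmapM forget) -[RHS](fmapM forget).
congr (fmap forget); apply: free_hom_ext => x.
by rewrite /= free_lift_gen /= !counit_gen.
Qed.

Program Definition oem_to_alg : functor OmegaEM (EilenbergMoore free_monad) :=
  @Functor OmegaEM (EilenbergMoore free_monad) oem_alg
    (fun M N f => @AlgebraHom BPos free_monad (oem_alg M) (oem_alg N)
      (fmap forget f) _) _ _.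
Next Obligation.
move=> M N f; rewrite -[LHS](fmapM forget) -[RHS](fmapM forget).
congr (fmap forget); apply: free_hom_ext => x.
by rewrite /= free_lift_gen /= !counit_gen.
Qed.
Next Obligation. by move=> M; apply: algebra_hom_eq; exact: bposet_hom_ext. Qed.
Next Obligation.
by move=> M N P g f; apply: algebra_hom_eq; exact: bposet_hom_ext.
Qed.

Section Unit.
Variable A : algebra free_monad.
Local Notation X := (alg_ob A : bposet).
Local Notation B := (oem_alg (alg_oem A)).

Program Definition alg_unit_map : bposet_hom X (alg_ob B : bposet) :=
  @BPosetHom X (alg_ob B : bposet) (fun x => x) _ _ _.
Next Obligation. by move=> x y xy; exact/ea_bposet_leP/alg_oem_leP. Qed.
Next Obligation. by []. Qed.
Next Obligation. by symmetry; exact: (dmonoid_ea1 (alg_dmonoid A)). Qed.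

Program Definition alg_unit_inv : bposet_hom (alg_ob B : bposet) X :=
  @BPosetHom (alg_ob B : bposet) X (fun x => x) _ _ _.
Next Obligation. by move=> x y xy; exact/alg_oem_leP/ea_bposet_leP. Qed.
Next Obligation. by []. Qed.
Next Obligation. exact: (dmonoid_ea1 (alg_dmonoid A)). Qed.

(** The structure map of the algebra and the evaluation of formal operations
    in the omega-effect monoid built from it are homomorphisms that agree on
    generators. *)
Program Definition alg_unit_hom : algebra_hom A B :=
  @AlgebraHom BPos free_monad A B alg_unit_map _.
Next Obligation.
apply: bposet_hom_ext => p.
suff e : alg_str_hom A =
    oem_comp (counit (alg_oem A))
      (fmap free_functor (alg_unit_map : @hom BPos _ _)).
  exact: (congr1 (fun f : oem_hom _ (alg_oem A) => f p) e).
apply: free_hom_ext => x /=; rewrite free_lift_gen counit_gen.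
exact: alg_str_gen.
Qed.

Program Definition alg_unit_inv_hom : algebra_hom B A :=
  @AlgebraHom BPos free_monad B A alg_unit_inv _.
Next Obligation.
apply: bposet_hom_ext => p.
suff e : counit (alg_oem A) =
    oem_comp (alg_str_hom A)
      (fmap free_functor (alg_unit_inv : @hom BPos _ _)).
  exact: (congr1 (fun f : oem_hom _ (alg_oem A) => f p) e).
apply: free_hom_ext => x; rewrite /= free_lift_gen counit_gen.
by symmetry; exact: alg_str_gen.
Qed.

End Unit.

Section Counit.
Variable M : omega_effect_monoid.

Lemma oem_alg_leP (x y : M) : @ea_le (alg_oem (oem_alg M)) x y <-> ea_le x y.
Proof.
by split=> [/alg_oem_leP/ea_bposet_leP//|xy]; exact/alg_oem_leP/ea_bposet_leP.
Qed.

Program Definition oem_counit : oem_hom (alg_oem (oem_alg M)) M :=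
  @mk_oem_hom (alg_oem (oem_alg M)) M (fun x => x) _ _ _ _ _.
Next Obligation. exact: (dmonoid_ea1 (alg_dmonoid (oem_alg M))). Qed.
Next Obligation. by move=> x y /oem_alg_leP. Qed.
Next Obligation.
move=> x y /oem_alg_leP xy; rewrite alg_oem_ediff; last exact/ea_bposet_leP.
rewrite /alg_diff /= ea_hom_ediff ?counit_gen//.
by apply: gen_le; exact/ea_bposet_leP.
Qed.
Next Obligation. by move=> x y; rewrite /= /alg_mul /= oem_homM !counit_gen. Qed.
Next Obligation.
move=> u s u_incr [us su]; split=> [n|y uy]; first exact/oem_alg_leP.
by apply/oem_alg_leP/su => n; exact/oem_alg_leP.
Qed.

End Counit.

Lemma alg_oem_quasi_inverse : quasi_inverse alg_to_oem oem_to_alg.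
Proof.
split.
- unshelve eexists.
    apply: (@Nattrans _ _ (functor_id _) (functor_comp oem_to_alg alg_to_oem)
      alg_unit_hom).
    by move=> A B f; apply: algebra_hom_eq; exact: bposet_hom_ext.
  move=> A; exists (alg_unit_inv_hom A).
  by split; apply: algebra_hom_eq; exact: bposet_hom_ext.
- unshelve eexists.
    apply: (@Nattrans _ _ (functor_comp alg_to_oem oem_to_alg) (functor_id _)
      oem_counit).
    by move=> M N f; exact: oem_hom_ext.
  move=> M; apply: oem_bijective_is_iso => [a b|y]; last by exists y.
  by move=> /oem_alg_leP.
Qed.

(** * Rearranging partial sums; suprema and multiplication *)

(** Sums made total by an absorbing undefined value [None]. The laws of the
    partial sum become those of a commutative monoid, whose lemmas do the
    rearranging. *)
Definition formal (E : effect_algebra) : Type := option E.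
HB.instance Definition _ (E : effect_algebra) := Choice.on (formal E).

Section Formal.
Variable E : effect_algebra.

Definition formal_elt (a : E) : formal E := Some a.

Definition formal_add (s t : formal E) : formal E :=
  if s is Some a then if t is Some b then oplus a b else None else None.

Lemma formal_addC : commutative formal_add.
Proof.
move=> [a|] [b|] //=; case ab : (oplus a b) => [c|]; first by rewrite (oplusC ab).
by case ba : (oplus b a) => [c|//]; rewrite (oplusC ba) in ab.
Qed.

Lemma formal_addA : associative formal_add.
Proof.
have half (a b c : formal E) d : formal_add (formal_add a b) c = Some d ->
    formal_add a (formal_add b c) = Some d.
  case: a b c => [a|] [b|] [c|] //=; case ab : oplus => [ab'|] //= abc.
  by have [bc -> /= ->] := oplusA ab abc.
move=> a b c.
case e : (formal_add (formal_add a b) c) => [d|]; first exact: half.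
case e' : (formal_add a (formal_add b c)) => [d|//].
move: e'; rewrite formal_addC (formal_addC b) => /half.
by rewrite formal_addC (formal_addC b) e.
Qed.

Lemma formal_add0 : left_id (formal_elt ea0) formal_add.
Proof. by case=> [a|//]; exact: oplus0x. Qed.

HB.instance Definition _ :=
  GRing.isNmodule.Build (formal E) formal_addA formal_addC formal_add0.

End Formal.

Notation "a %:fs" := (formal_elt a) (at level 1, format "a %:fs").

Section FormalTheory.
Variable E : effect_algebra.
Implicit Types (a b c : E) (s t : formal E).

Lemma formalP a b c : oplus a b = Some c <-> a%:fs + b%:fs = c%:fs.
Proof. by []. Qed.

Lemma formal_elt_inj : injective (@formal_elt E).
Proof. by move=> a b [->]. Qed.

Lemma formal0 : (ea0 : E)%:fs = 0. Proof. by []. Qed.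

Lemma formal_defl s t c : s + t = c%:fs -> exists a, s = a%:fs.
Proof. by case: s => [a|//] _; exists a. Qed.

Lemma formal_defr s t c : s + t = c%:fs -> exists a, t = a%:fs.
Proof. by rewrite addrC; exact: formal_defl. Qed.

Lemma formal_cancel s t t' c : s + t = c%:fs -> s + t' = c%:fs -> t = t'.
Proof.
case: s t t' => [a|//] [b|//] [b'|//] ab ab'; congr (_ %:fs).
exact: oplus_cancel ab ab'.
Qed.

Lemma formal_orth a : a%:fs + (orth a)%:fs = ea1%:fs.
Proof. exact: oplus_orth. Qed.

Lemma formal_ediff a b : ea_le a b -> a%:fs + (ediff b a)%:fs = b%:fs.
Proof. exact: oplus_ediff. Qed.

Lemma formal_add_eq0 a b : a%:fs + b%:fs = 0 -> a = ea0.
Proof. by move=> ab; apply: ea_le0; exists b. Qed.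

(** The algebraic preorder of formal sums, with the undefined sum on top. *)
Definition formal_leq s t := exists r, t = s + r.

Lemma formal_leq_elt a b : formal_leq a%:fs b%:fs <-> ea_le a b.
Proof.
split=> [[r ab]|[c ab]]; last by exists c%:fs; rewrite -[RHS]/(formal_add _ _) /= ab.
by have [c rc] := formal_defr (esym ab); exists c; rewrite rc in ab.
Qed.

Lemma formal_leqD s s' t t' :
  formal_leq s s' -> formal_leq t t' -> formal_leq (s + t) (s' + t').
Proof. by move=> [r ->] [r' ->]; exists (r + r'); rewrite addrACA. Qed.

Lemma formal_leq_trans s t r : formal_leq s t -> formal_leq t r -> formal_leq s r.
Proof. by move=> [x ->] [y ->]; exists (x + y); rewrite addrA. Qed.

Lemma formal_leqxx s : formal_leq s s. Proof. by exists 0; rewrite addr0. Qed.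

Lemma formal_leq_def s a : formal_leq s a%:fs -> exists b, s = b%:fs.
Proof. by move=> [r /esym/formal_defl]. Qed.

Lemma oplus_le a a' b b' c c' : oplus a b = Some c -> oplus a' b' = Some c' ->
  ea_le a a' -> ea_le b b' -> ea_le c c'.
Proof.
move=> /formalP ab /formalP ab' /formal_leq_elt aa' /formal_leq_elt bb'.
by apply/formal_leq_elt; rewrite -ab -ab'; exact: formal_leqD.
Qed.

Lemma oplus_def_le a a' b b' c' : oplus a' b' = Some c' ->
  ea_le a a' -> ea_le b b' -> exists c, oplus a b = Some c.
Proof.
move=> /formalP ab' /formal_leq_elt aa' /formal_leq_elt bb'.
have := formal_leqD aa' bb'; rewrite ab' => /formal_leq_def[c abc].
by exists c.
Qed.

Lemma oplus_def a b : (exists c, oplus a b = Some c) <-> ea_le b (orth a).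
Proof.
split=> [[c abc]|ba].
  have [d bd ad] := oplusA abc (oplus_orth c).
  by exists (orth c); rewrite -(orth_unique ad).
by apply: oplus_def_le (oplus_orth a) _ ba; exact: ea_le_refl.
Qed.

Lemma ediff_swap a b c : ea_le a c -> ea_le b (ediff c a) -> ea_le a (ediff c b).
Proof.
move=> ac bca; rewrite -[a](ediffK ac).
by apply: ediff_anti => //; exact: ediff_le.
Qed.

Lemma ediff_eq0 a b : ea_le a b -> ediff b a = ea0 -> a = b.
Proof.
by move=> /formal_ediff ab e; move: ab; rewrite e formal0 addr0 => /formal_elt_inj.
Qed.

(** An omega-complete effect algebra has no infinitesimal: the supremum [s]
    of [u] would satisfy [s <= s - a]. *)
Lemma is_sup_archimedean (u : nat -> E) (s : E) a :
  is_sup u s -> (forall n, exists2 c, oplus a (u n) = Some c & ea_le c (u n.+1)) ->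
  a = ea0.
Proof.
move=> [us su] au.
have a_s : ea_le a s.
  have [c ac cu] := au 0%N; apply: ea_le_trans (ea_le_trans cu (us _)).
  exact: ea_le_oplus ac.
have : ea_le s (ediff s a).
  apply: su => n; have [c ac cu] := au n.
  have cs := ea_le_trans cu (us _).
  rewrite -(ediff_oplus ac); have ac' := ea_le_oplus ac.
  have /formalP h := oplus_ediff_trans ac' cs.
  by apply/formal_leq_elt; rewrite -h; exists (ediff s c)%:fs.
move=> /(ea_le_anti (ediff_le a s)) e.
by rewrite -(ediffK a_s) e ediffxx.
Qed.

Lemma is_sup_const a : is_sup (fun=> a) a.
Proof. by split=> [_|y /(_ 0%N)//]; exact: ea_le_refl. Qed.

Lemma is_sup_oplus (u v : nat -> E) a (s t : E) : is_sup u s ->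
  (forall n, oplus a (u n) = Some (v n)) -> oplus a s = Some t -> is_sup v t.
Proof.
move=> [us su] auv ast; split=> [n|y vy].
  by apply: oplus_le (auv n) ast (ea_le_refl a) (us n).
have ay := ea_le_trans (ea_le_oplus (auv 0%N)) (vy 0%N).
have sy : ea_le s (ediff y a).
  apply: su => n; rewrite -(ediff_oplus (auv n)).
  have /formalP h := oplus_ediff_trans (ea_le_oplus (auv n)) (vy n).
  by apply/formal_leq_elt; rewrite -h; exists (ediff y (v n))%:fs.
exact: oplus_le ast (oplus_ediff ay) (ea_le_refl a) sy.
Qed.

Lemma is_sup_shift (u : nat -> E) (s : E) : incr u -> is_sup u s ->
  is_sup (fun n => u n.+1) s.
Proof.
move=> ui [us su]; split=> [n|y uy]; first exact: us.
by apply: su => n; exact: ea_le_trans (ui n) (uy n).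
Qed.

(** The gap between [t] and the supremum of [v] lies below every [s - u n],
    hence is [0]. *)
Lemma is_sup_squeeze (u v : nat -> E) (s t : E) :
  is_sup u s -> omega_complete (ea_bposet E) -> incr v ->
  (forall n, ea_le (v n) t) ->
  (forall n, ea_le (ediff t (v n)) (ediff s (u n))) -> is_sup v t.
Proof.
move=> [us su] E_complete vi vt tvsu.
have [r /is_supP [vr rv]] := E_complete v ((incrP _).1 vi).
have rt : ea_le r t by exact: rv.
suff e : ediff t r = ea0 by rewrite -(ediff_eq0 rt e).
have ds n : ea_le (ediff t r) (ediff s (u n)).
  by apply: ea_le_trans (tvsu n); exact: ediff_anti.
have ts := ea_le_trans (ds 0%N) (ediff_le _ _).
have : ea_le s (ediff s (ediff t r)).
  by apply: su => n; exact: ediff_swap.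
move=> /(ea_le_anti (ediff_le _ _)) e.
by rewrite -(ediffK ts) e ediffxx.
Qed.

End FormalTheory.

Section EffectMonoidMul.
Variable M : effect_monoid.
Implicit Types x y z : M.

Lemma emulx0 x : emul x ea0 = ea0.
Proof. by have h := emulDr x (oplus0 ea0); rewrite -(ediff_oplus h) ediffxx. Qed.

Lemma emul0x x : emul ea0 x = ea0.
Proof. by have h := emulDl x (oplus0 ea0); rewrite -(ediff_oplus h) ediffxx. Qed.

Lemma emul_le_l x y : ea_le (emul x y) x.
Proof. by rewrite -{2}[x]emulx1; apply: emul_ler; exact: ea_le1. Qed.

Lemma emul_le_r x y : ea_le (emul x y) y.
Proof. by rewrite -{2}[y]emul1x; apply: emul_lel; exact: ea_le1. Qed.

Lemma emul_le x x' y y' : ea_le x x' -> ea_le y y' ->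
  ea_le (emul x y) (emul x' y').
Proof. by move=> xx yy; apply: ea_le_trans (emul_lel _ xx) (emul_ler _ yy). Qed.

Lemma emul_orthr x y : (emul x y)%:fs + (emul x (orth y))%:fs = x%:fs.
Proof. by rewrite -{3}[x]emulx1; exact: emulDr (oplus_orth y). Qed.

Lemma emul_orthl x y : (emul x y)%:fs + (emul (orth x) y)%:fs = y%:fs.
Proof. by rewrite -{3}[y]emul1x; exact: emulDl (oplus_orth x). Qed.

Lemma emul_orthrC x : emul x (orth x) = emul (orth x) x.
Proof.
by apply: formal_elt_inj; apply: (formal_cancel (emul_orthr x x) (emul_orthl x x)).
Qed.

Lemma emul_commute_orth x y : emul x y = emul y x ->
  emul x (orth y) = emul (orth y) x.
Proof.
move=> xy; apply: formal_elt_inj.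
by apply: (formal_cancel (emul_orthr x y)); rewrite xy; exact: emul_orthl.
Qed.

End EffectMonoidMul.

Section Normality.
Variable M : omega_effect_monoid.
Implicit Types (x y : M) (u v : nat -> M).

(** Multiplication is normal because [x * c <= c] for every [c], so that the
    gaps [x * s - x * u n] are dominated by the gaps [s - u n]. *)
Lemma is_sup_mulr x u (s : M) : incr u -> is_sup u s ->
  is_sup (fun n => emul x (u n)) (emul x s).
Proof.
move=> ui us; apply: is_sup_squeeze (us) _ _ _ _.
- exact: oem_complete.
- by move=> n; exact/emul_ler/ui.
- by move=> n; apply/emul_ler/us.1.
- by move=> n; rewrite -emul_ediffr; [exact: emul_le_r|exact: us.1].
Qed.

Lemma is_sup_mull x u (s : M) : incr u -> is_sup u s ->
  is_sup (fun n => emul (u n) x) (emul s x).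
Proof.
move=> ui us; apply: is_sup_squeeze (us) _ _ _ _.
- exact: oem_complete.
- by move=> n; exact/emul_lel/ui.
- by move=> n; apply/emul_lel/us.1.
- by move=> n; rewrite -emul_ediffl; [exact: emul_le_l|exact: us.1].
Qed.

(** The diagonal is cofinal in a doubly increasing array. *)
Lemma is_sup_diag (w : nat -> nat -> M) (v : nat -> M) (s : M) :
  (forall m m' n n', (m <= m')%N -> (n <= n')%N -> ea_le (w m n) (w m' n')) ->
  (forall m, is_sup (w m) (v m)) -> is_sup v s -> is_sup (fun n => w n n) s.
Proof.
move=> wi wv [vs sv]; split=> [n|y wy].
  exact: ea_le_trans ((wv n).1 n) (vs n).
apply: sv => m; apply: (wv m).2 => n.
by apply: ea_le_trans (wy (maxn m n)); apply: wi; [exact: leq_maxl|exact: leq_maxr].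
Qed.

Definition normal_map (F : M -> M) := forall u (s : M), incr u -> is_sup u s ->
  incr (F \o u) /\ is_sup (F \o u) (F s).

(** Kleene iteration from [0]. *)
Lemma normal_fixpoint (F : M -> M) : normal_map F ->
  {h | [/\ F h = h, incr (fun n => iter n F ea0) &
           is_sup (fun n => iter n F ea0) h]}.
Proof.
move=> nF; pose u n := iter n F (ea0 : M).
have F_le x y : ea_le x y -> ea_le (F x) (F y).
  move=> xy; pose w n := if n is 0%N then x else y.
  have wi : incr w by case=> [|n] //=; exact: ea_le_refl.
  have ws : is_sup w y.
    by split=> [[|n] //=|z /(_ 1%N)//]; exact: ea_le_refl.
  by have [/(_ 0%N)] := nF w y wi ws.
have ui : incr u by elim=> [|n IH]; [exact: ea_ge0|exact: F_le].
have us := esupP ui; exists (esup u); split=> //.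
have [_ Fus] := nF _ _ ui us.
exact: is_sup_unique Fus (is_sup_shift ui us).
Qed.

End Normality.

(** * Products, idempotents and irreducibility *)

Program Definition trivial_dmonoid : dmonoid unit :=
  @subproduct unit False (fun i => match i with end)
    (fun i _ => match i with end) tt tt (fun _ _ => tt) (fun _ _ => tt)
    _ _ _ _ _ _.
Next Obligation. by case=> [] []. Qed.
Next Obligation. by []. Qed.
Next Obligation. by []. Qed.
Next Obligation. by move=> x y _ []. Qed.
Next Obligation. by move=> x y []. Qed.
Next Obligation. by move=> u _; exists tt; case. Qed.

Definition trivial_oem := dmonoid_oem trivial_dmonoid.

(** The one-point effect monoid maps only to effect monoids with [0 = 1],
    and these have a single element. *)
Lemma finalP (M : OmegaEM) : final M <-> ea0 = ea1 :> M.
Proof.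
split=> [/(_ trivial_oem) [f _]|M01].
  by rewrite -(ea_hom0 (f : oem_hom _ _)) -(ea_hom1 (f : oem_hom _ _)).
have M0 (x : M) : x = ea0 by apply: ea_le0; rewrite M01; exact: ea_le1.
have Meq (x y : M) : x = y by rewrite (M0 x) (M0 y).
move=> N; have f : oem_hom N M.
  apply: (@mk_oem_hom N M (fun=> ea0)) => // [a b _|u s _ _].
    exact: ea_le_refl.
  by split=> [n|y _]; exact: ea_ge0.
by exists f => g; apply: oem_hom_ext => x; exact: Meq.
Qed.

Section Product.
Variables M N : omega_effect_monoid.

Let fac (i : bool) := if i then M else N.
Let coord (i : bool) (x : M * N) : fac i :=
  match i return fac i with true => x.1 | false => x.2 end.

Program Definition product_dmonoid : dmonoid (M * N)%type :=
  @subproduct (M * N)%type bool fac coord (ea0, ea0) (ea1, ea1)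
    (fun y x => (ediff y.1 x.1, ediff y.2 x.2))
    (fun x y => (emul x.1 y.1, emul x.2 y.2)) _ _ _ _ _ _.
Next Obligation.
by move=> [a b] [c d] e; congr (_, _); [exact: (e true)|exact: (e false)].
Qed.
Next Obligation. by case. Qed.
Next Obligation. by case. Qed.
Next Obligation. by move=> x y _ []. Qed.
Next Obligation. by move=> x y []. Qed.
Next Obligation.
move=> u ui; have u1 := esupP (ui true); have u2 := esupP (ui false).
by exists (esup (fst \o u), esup (snd \o u)); case.
Qed.

Definition product_oem := dmonoid_oem product_dmonoid.

Lemma product_leP (x y : product_oem) :
  ea_le x y <-> ea_le x.1 y.1 /\ ea_le x.2 y.2.
Proof.
split=> [/(@dmonoid_leP _ product_dmonoid) xy|[xy1 xy2]].
  by split; [exact: (xy true)|exact: (xy false)].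
by apply/(@dmonoid_leP _ product_dmonoid); case.
Qed.

Lemma product_ediff (x y : product_oem) : ea_le x y ->
  ediff y x = (ediff y.1 x.1, ediff y.2 x.2).
Proof.
by move=> /(@dmonoid_leP _ product_dmonoid) xy;
  rewrite (@dmonoid_ediff _ product_dmonoid).
Qed.

(** Suprema in the product are computed componentwise because the
    componentwise supremum exists. *)
Lemma product_is_supP (u : nat -> product_oem) (s : product_oem) : incr u ->
  is_sup u s <-> is_sup (fun n => (u n).1) s.1 /\ is_sup (fun n => (u n).2) s.2.
Proof.
move=> ui.
have ui1 : incr (fun n => (u n).1) by move=> n; have /product_leP[] := ui n.
have ui2 : incr (fun n => (u n).2) by move=> n; have /product_leP[] := ui n.
suff H : @is_sup product_oem u (esup (fun n => (u n).1), esup (fun n => (u n).2)).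
  split=> [us|[us1 us2]].
    by rewrite (is_sup_unique us H); split; exact: esupP.
  rewrite (surjective_pairing s) (is_sup_unique us1 (esupP ui1)).
  by rewrite (is_sup_unique us2 (esupP ui2)).
split=> [n|y uy]; apply/product_leP.
  by split; apply: (esupP _).1.
by split; [apply: (esupP ui1).2|apply: (esupP ui2).2] => n;
  have /product_leP[] := uy n.
Qed.

Lemma product_ea1 : ea1 = (ea1, ea1) :> product_oem.
Proof. exact: (dmonoid_ea1 product_dmonoid). Qed.

Program Definition product_fst : oem_hom product_oem M :=
  @mk_oem_hom product_oem M fst _ _ _ _ _.
Next Obligation. by rewrite product_ea1. Qed.
Next Obligation. by move=> x y /product_leP[]. Qed.
Next Obligation. by move=> x y /product_ediff ->. Qed.
Next Obligation. by []. Qed.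
Next Obligation. by move=> u s ui /(product_is_supP _ ui)[]. Qed.

Program Definition product_snd : oem_hom product_oem N :=
  @mk_oem_hom product_oem N snd _ _ _ _ _.
Next Obligation. by rewrite product_ea1. Qed.
Next Obligation. by move=> x y /product_leP[]. Qed.
Next Obligation. by move=> x y /product_ediff ->. Qed.
Next Obligation. by []. Qed.
Next Obligation. by move=> u s ui /(product_is_supP _ ui)[]. Qed.

Program Definition product_pair (L : omega_effect_monoid) (f : oem_hom L M)
    (g : oem_hom L N) : oem_hom L product_oem :=
  @mk_oem_hom L product_oem (fun x => (f x, g x)) _ _ _ _ _.
Next Obligation. by move=> L f g; rewrite product_ea1 !ea_hom1. Qed.
Next Obligation.
by move=> L f g a b ab; apply/product_leP; split; exact: ea_hom_le.
Qed.
Next Obligation.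
move=> L f g a b ab; rewrite product_ediff ?ea_hom_ediff//.
by apply/product_leP; split; exact: ea_hom_le.
Qed.
Next Obligation. by move=> L f g a b /=; rewrite !oem_homM. Qed.
Next Obligation.
move=> L f g u s ui us; apply/product_is_supP.
  by move=> n; apply/product_leP; split; exact/ea_hom_le/ui.
by split; exact: oem_hom_sup us.
Qed.

Lemma product_is_product :
  @is_product OmegaEM M N product_oem product_fst product_snd.
Proof.
move=> L f g; exists (product_pair f g); split.
  by split; exact: oem_hom_ext.
move=> h [<- <-]; apply: oem_hom_ext => x.
by rewrite [RHS]surjective_pairing.
Qed.

End Product.

Section Idempotents.
Variable M : effect_monoid.
Variable e : M.
Hypothesis ee : emul e e = e.

Lemma idem_mul_orth : emul e (orth e) = ea0.
Proof.
have := emul_orthr e e; rewrite ee => h.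
by apply: formal_elt_inj; apply: (formal_cancel h); rewrite formal0 addr0.
Qed.

Lemma idem_orth_mul : emul (orth e) e = ea0.
Proof. by rewrite -emul_orthrC idem_mul_orth. Qed.

Lemma idem_orth : emul (orth e) (orth e) = orth e.
Proof.
have := emul_orthl e (orth e).
by rewrite idem_mul_orth formal0 add0r => /formal_elt_inj.
Qed.

Lemma idem_mulK x : ea_le x e -> emul e x = x.
Proof.
move=> xe; have /ea_le0 h : ea_le (emul (orth e) x) ea0.
  by rewrite -idem_orth_mul; exact: emul_ler.
by have := emul_orthl e x; rewrite h formal0 addr0 => /formal_elt_inj.
Qed.

Lemma idem_mulKr x : ea_le x e -> emul x e = x.
Proof.
move=> xe; have /ea_le0 h : ea_le (emul x (orth e)) ea0.
  by rewrite -idem_mul_orth; exact: emul_lel.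
by have := emul_orthr x e; rewrite h formal0 addr0 => /formal_elt_inj.
Qed.

(** Idempotents are central: both products lie below [e]. *)
Lemma idem_central x : emul e x = emul x e.
Proof.
rewrite -(idem_mulKr (emul_le_l e x)) -[RHS](idem_mulK (emul_le_r x e)).
by rewrite emulA.
Qed.

End Idempotents.

(** The corner of an idempotent [e] is the interval below [e], with the
    order, the difference and the multiplication of the whole and with unit
    [e]. *)
Section Corner.
Variable M : omega_effect_monoid.
Variable e : M.
Hypothesis ee : emul e e = e.

Definition corner_sort : Type := {x : M | `[<ea_le x e>]}.
HB.instance Definition _ := Choice.on corner_sort.

Lemma corner_le (x : corner_sort) : ea_le (val x) e.
Proof. exact: (asboolW (valP x)). Qed.

Definition corner_elt x (xe : ea_le x e) : corner_sort := exist _ x (asboolT xe).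

Let diff_le (y x : corner_sort) : ea_le (ediff (val y) (val x)) e :=
  ea_le_trans (ediff_le _ _) (corner_le y).
Let mul_le (x y : corner_sort) : ea_le (emul (val x) (val y)) e :=
  ea_le_trans (emul_le_l _ _) (corner_le x).

Program Definition corner_dmonoid : dmonoid corner_sort :=
  @DMonoid corner_sort (fun x y => ea_le (val x) (val y))
    (corner_elt (ea_ge0 e)) (corner_elt (ea_le_refl e))
    (fun y x => corner_elt (diff_le y x)) (fun x y => corner_elt (mul_le x y))
    _ _ _ _ _ _ _ _ _ _ _ _ _ _ _ _ _.
Next Obligation. by move=> a; exact: ea_le_refl. Qed.
Next Obligation. by move=> a b c; exact: ea_le_trans. Qed.
Next Obligation. by move=> a b ab ba; apply: val_inj; exact: ea_le_anti. Qed.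
Next Obligation. by move=> a; exact: ea_ge0. Qed.
Next Obligation. by move=> a; exact: corner_le. Qed.
Next Obligation. by move=> a b _; exact: ediff_le. Qed.
Next Obligation. by move=> a b ab; apply: val_inj; exact: ediffK. Qed.
Next Obligation. by move=> a b c; exact: ediff_anti. Qed.
Next Obligation. by move=> a b c ab bc; apply: val_inj; exact: ediff_ediff. Qed.
Next Obligation. by move=> a b c; apply: val_inj; exact: emulA. Qed.
Next Obligation.
by move=> a; apply: val_inj; apply: idem_mulKr => //; exact: corner_le.
Qed.
Next Obligation.
by move=> a; apply: val_inj; apply: idem_mulK => //; exact: corner_le.
Qed.
Next Obligation. by move=> a b c; exact: emul_ler. Qed.
Next Obligation. by move=> a b c; exact: emul_lel. Qed.
Next Obligation. by move=> a b c bc; apply: val_inj; exact: emul_ediffr. Qed.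
Next Obligation. by move=> a b c bc; apply: val_inj; exact: emul_ediffl. Qed.
Next Obligation.
move=> u ui; have [us su] := esupP (u := fun n => val (u n)) ui.
have se : ea_le (esup (fun n => val (u n))) e.
  by apply: su => n; exact: corner_le.
by exists (corner_elt se); split=> // y uy; exact: su.
Qed.

Definition corner_oem := dmonoid_oem corner_dmonoid.

Lemma corner_leP (x y : corner_oem) :
  ea_le x y <-> ea_le (val (x : corner_sort)) (val (y : corner_sort)).
Proof. exact (@dmonoid_leP _ corner_dmonoid x y). Qed.

Lemma corner_ea1 : ea1 = corner_elt (ea_le_refl e) :> corner_oem.
Proof. exact: (dmonoid_ea1 corner_dmonoid). Qed.

Program Definition corner_proj : oem_hom M corner_oem :=
  @mk_oem_hom M corner_oem (fun x => corner_elt (emul_le_l e x)) _ _ _ _ _.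
Next Obligation.
by rewrite corner_ea1; apply: val_inj; rewrite /= emulx1.
Qed.
Next Obligation. by move=> a b ab; apply/corner_leP; exact: emul_ler. Qed.
Next Obligation.
move=> a b ab; rewrite (@dmonoid_ediff _ corner_dmonoid); last exact: emul_ler.
by apply: val_inj; exact: emul_ediffr.
Qed.
Next Obligation.
move=> a b; apply: val_inj => /=.
by rewrite -(emulA e a) (emulA a) -(idem_central ee a) !emulA ee.
Qed.
Next Obligation.
move=> u s ui us; have [eu ue] := is_sup_mulr e ui us.
split=> [n|y uy]; apply/corner_leP; first exact: eu.
by apply: ue => n; have /corner_leP := uy n.
Qed.

End Corner.

Section Decomposition.
Variable M : omega_effect_monoid.
Variable e : M.
Hypothesis ee : emul e e = e.

(** The inverse sends [(x, y)] to the sum of [x] and [y], which are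
    orthogonal since they lie below [e] and [orth e]. *)
Lemma idem_decomposition :
  @isomorphic OmegaEM M
    (product_oem (corner_oem ee) (corner_oem (idem_orth ee))).
Proof.
exists (product_pair (corner_proj ee) (corner_proj (idem_orth ee))).
apply: oem_bijective_is_iso => [a b|[x y]].
  move=> /product_leP[/corner_leP/= ab1 /corner_leP/= ab2].
  exact: oplus_le (emul_orthl e a) (emul_orthl e b) ab1 ab2.
have xe := corner_le x; have ye := corner_le y.
have ey : emul e (val y) = ea0.
  by apply: ea_le0; rewrite -(idem_mul_orth ee); exact: emul_ler.
have e'x : emul (orth e) (val x) = ea0.
  by apply: ea_le0; rewrite -(idem_orth_mul ee); exact: emul_ler.
have [z xy] := oplus_def_le (oplus_orth e) xe ye.
exists z; congr (_, _); apply: val_inj => /=; apply: formal_elt_inj.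
  have /formalP := emulDr e xy.
  by rewrite ey formal0 addr0 (idem_mulK ee xe) => ->.
have /formalP := emulDr (orth e) xy.
by rewrite e'x formal0 add0r (idem_mulK (idem_orth ee) ye) => ->.
Qed.

End Decomposition.

(** Connectedness is meant as for rings. *)
Definition connected (M : effect_monoid) :=
  forall e : M, emul e e = e -> e = ea0 \/ e = ea1.

Lemma irreducible_connected (M : OmegaEM) : irreducible M -> connected M.
Proof.
move=> irr e ee.
have [/finalP|/finalP] :=
  irr _ _ _ _ _ (@product_is_product _ _) (idem_decomposition ee).
  by rewrite corner_ea1 => /(congr1 val) /= ->; left.
rewrite corner_ea1 => /(congr1 val) /= e0; right.
by rewrite -[e]orthK -e0.
Qed.

(** In a product [a * b] the element [(1, 0)] is idempotent; if it is [0] or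
    [1], its first or second coordinate shows that [0 = 1] in that factor. *)
Lemma connected_irreducible (M : OmegaEM) : connected M -> irreducible M.
Proof.
move=> Mc a b p pa pb prod [t [t' [t't tt']]].
have [h [[pah pbh] _]] := prod _ (product_fst a b : @hom OmegaEM _ _)
  (product_snd a b : @hom OmegaEM _ _).
pose x : product_oem a b := (ea1, ea0).
have xx : emul x x = x by congr (_, _); rewrite /= (emulx1, emulx0).
pose y := oem_comp t' h x.
have yy : emul y y = y by rewrite -oem_homM xx.
have ty : (t : oem_hom _ _) y = (h : oem_hom _ _) x.
  exact: (congr1 (fun f : oem_hom p p => f ((h : oem_hom _ _) x)) tt').
have pax : (pa : oem_hom p a) ((h : oem_hom _ _) x) = ea1.
  exact: (congr1 (fun f : oem_hom (product_oem a b) a => f x) pah).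
have pbx : (pb : oem_hom p b) ((h : oem_hom _ _) x) = ea0.
  exact: (congr1 (fun f : oem_hom (product_oem a b) b => f x) pbh).
case: (Mc y yy) => y01; [left|right]; apply/finalP.
  by rewrite -pax -ty y01 !ea_hom0.
by rewrite -pbx -ty y01 !ea_hom1.
Qed.

Program Definition bool_dmonoid : dmonoid bool :=
  @DMonoid bool implb false true (fun y x => y && ~~ x) andb
    _ _ _ _ _ _ _ _ _ _ _ _ _ _ _ _ _.
Next Obligation. by case. Qed.
Next Obligation. by do 3 case. Qed.
Next Obligation. by do 2 case. Qed.
Next Obligation. by case. Qed.
Next Obligation. by case. Qed.
Next Obligation. by do 2 case. Qed.
Next Obligation. by do 2 case. Qed.
Next Obligation. by do 3 case. Qed.
Next Obligation. by do 3 case. Qed.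
Next Obligation. exact: andbA. Qed.
Next Obligation. exact: andbT. Qed.
Next Obligation. by []. Qed.
Next Obligation. by do 3 case. Qed.
Next Obligation. by do 3 case. Qed.
Next Obligation. by do 3 case. Qed.
Next Obligation. by do 3 case. Qed.
Next Obligation.
move=> u ui; exists `[<exists n, u n>]; split=> [n|[] uy].
- by case un : (u n) => //=; apply/asboolP; exists n.
- by rewrite implybT.
- by case: asboolP => // -[n un]; have := uy n; rewrite un.
Qed.

Definition bool_oem := dmonoid_oem bool_dmonoid.

(** A half of [1] would be sent to a half of [1] in the Boolean algebra of
    truth values. *)
Lemma initial_no_half (M : OmegaEM) (h : M) : initial M -> oplus h h <> Some ea1.
Proof.
move=> /(_ bool_oem)[f _] /(ea_homD (f : oem_hom _ _)).
rewrite ea_hom1 => /(@doplusP _ bool_dmonoid).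
by rewrite (dmonoid_ea1 bool_dmonoid) /=; case: ((f : oem_hom _ _) h) => -[].
Qed.

Lemma two_element_initial (M : OmegaEM) :
  ea0 <> ea1 :> M -> (forall x : M, x = ea0 \/ x = ea1) -> initial M.
Proof.
move=> M01 Mx N.
pose f (x : M) : N := if x == ea0 then ea0 else ea1.
have f0 : f ea0 = ea0 by rewrite /f eqxx.
have f1 : f ea1 = ea1 by rewrite /f; case: eqP => // /esym/M01.
have f_le a b : ea_le a b -> ea_le (f a) (f b).
  have [->|->] := Mx a; first by rewrite f0 => _; exact: ea_ge0.
  by move=> /(ea_le_anti (ea_le1 _)) ->; exact: ea_le_refl.
have fd a b : ea_le a b -> f (ediff b a) = ediff (f b) (f a).
  have [->|->] := Mx a.
    by move=> _; rewrite f0 !(ediff_oplus (oplus0x _)).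
  by move=> /(ea_le_anti (ea_le1 _)) ->; rewrite f1 !ediffxx.
have fM a b : f (emul a b) = emul (f a) (f b).
  have [->|->] := Mx a; first by rewrite !(emul0x, f0).
  by rewrite f1 !emul1x.
have fs (u : nat -> M) s : incr u -> is_sup u s -> is_sup (f \o u) (f s).
  move=> ui [us su]; split=> [n|y fuy]; first exact/f_le/us.
  have [[n un]|u0] := pselect (exists n, u n = ea1).
    have -> : s = ea1 by apply: ea_le_anti (ea_le1 _) _; rewrite -un.
    by rewrite -un; exact: fuy.
  have -> : s = ea0.
    apply: ea_le0; apply: su => n; have [->|un] := Mx (u n).
      exact: ea_le_refl.
    by case: u0; exists n.
  by rewrite f0; exact: ea_ge0.
exists (mk_oem_hom f1 f_le fd fM fs) => g; apply: oem_hom_ext => x /=.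
have [->|->] := Mx x; first by rewrite f0; exact: ea_hom0.
by rewrite f1; exact: ea_hom1.
Qed.

(** * Omega-effect monoids with trivial idempotents *)

(** Let [p n] be the powers of [orth x] and [e] their infimum. From [x * p n
    = p n - p n.+1] it follows that [x * e] is an infinitesimal, so [x * e =
    0]; then [p n * e = e] for all [n], hence [e * e = e] by normality. If
    [x * y = 0] then [orth x * y = y], whence [y <= p n] for all [n] and [y
    <= e]. Now [e = 0] gives [y = 0], and [e = 1] gives [x = 0]. *)
Lemma connected_integral (M : omega_effect_monoid) (x y : M) :
  connected M -> emul x y = ea0 -> x = ea0 \/ y = ea0.
Proof.
move=> Mc xy; pose p n := iter n (emul (orth x)) ea1.
pose q n := orth (p n).
have pS n : p n.+1 = emul (orth x) (p n) by [].
have step n c : ea_le c (p n) ->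
    exists2 d, oplus (emul x c) (q n) = Some d & ea_le d (q n.+1).
  move=> cp.
  have qS : oplus (emul x (p n)) (q n) = Some (q n.+1).
    apply/formalP.
    apply: (@formal_cancel _ (p n.+1)%:fs _ _ ea1); last exact: formal_orth.
    by rewrite addrA [X in X + _]addrC pS emul_orthl formal_orth.
  have [d xcq] := oplus_def_le qS (emul_ler x cp) (ea_le_refl (q n)).
  by exists d => //; apply: oplus_le xcq qS (emul_ler x cp) (ea_le_refl (q n)).
have qi : incr q.
  move=> n; have [d /oplusC/ea_le_oplus qd dq] := step n _ (ea_ge0 _).
  exact: ea_le_trans qd dq.
have qf := esupP qi; set f := esup q in qf; pose e := orth f.
have ep n : ea_le e (p n) by rewrite -[p n]orthK; exact/orth_anti/qf.1.
have xe : emul x e = ea0.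
  by apply: (is_sup_archimedean qf) => n; exact: step.
have pe n : emul (p n) e = e.
  elim: n => [|n IH]; first exact: emul1x.
  rewrite pS -emulA IH; apply: formal_elt_inj.
  by have := emul_orthl x e; rewrite xe formal0 add0r.
have qe n : emul (q n) e = ea0.
  apply: formal_elt_inj; apply: (formal_cancel (emul_orthl (p n) e)).
  by rewrite pe formal0 addr0.
have fe : emul f e = ea0.
  have := is_sup_mull e qi qf.
  have -> : (fun n => emul (q n) e) = (fun=> ea0) by apply/funext => n.
  by move=> /is_sup_unique/(_ (is_sup_const _)).
have ee : emul e e = e.
  by apply: formal_elt_inj; rewrite -{3}(emul1x e) -[RHS](emul_orthl f) emul1x
     fe formal0 add0r.
have ye : ea_le y e.
  rewrite -[y]orthK; apply: orth_anti; apply: qf.2 => n; apply: orth_anti.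
  elim: n => [|n IH]; first exact: ea_le1.
  suff -> : y = emul (orth x) y by exact: emul_ler.
  by apply: formal_elt_inj; rewrite -{1}(emul_orthl x y) xy formal0 add0r.
have [e0|e1] := Mc e ee; first by right; apply: ea_le0; rewrite -e0.
by left; rewrite -xe e1 emulx1.
Qed.

Section Integral.
Variable M : omega_effect_monoid.
Hypothesis M_integral : forall x y : M, emul x y = ea0 -> x = ea0 \/ y = ea0.
Implicit Types a b c x y : M.

Definition osum a b : M := odflt ea0 (oplus a b).

Lemma osumP a b : ea_le b (orth a) -> oplus a b = Some (osum a b).
Proof. by move=> /oplus_def[c abc]; rewrite /osum abc. Qed.

Lemma normal_osum a (F : M -> M) : (forall x, ea_le (F x) (orth a)) ->
  normal_map F -> normal_map (fun x => osum a (F x)).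
Proof.
move=> Fa nF u s ui us; have [Fui Fus] := nF u s ui us; split=> [n|].
  exact: oplus_le (osumP (Fa _)) (osumP (Fa _)) (ea_le_refl a) (Fui n).
by apply: is_sup_oplus Fus _ _ => [n|]; exact/osumP/Fa.
Qed.

Lemma orth_le_sum a b c : oplus a b = Some c -> ea_le b (orth a).
Proof. by move=> abc; apply/oplus_def; exists c. Qed.

(** The two summands are [a * orth a <= a] and [a * orth a <= orth a]. *)
Lemma emul_orth_double a :
  exists b, oplus (emul a (orth a)) (emul a (orth a)) = Some b.
Proof.
apply: (oplus_def_le (oplus_orth a)); first exact: emul_le_l.
exact: emul_le_r.
Qed.

(** The fair coin that von Neumann extracts from a coin of bias [a]: [d] is
    the probability of each of the two mixed outcomes of a pair of tosses,
    and [h = d + (1 - 2 d) h] is the probability that the first pair with a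
    mixed outcome shows a given one of them. *)
Lemma half_exists a : a <> ea0 -> a <> ea1 -> exists h : M, oplus h h = Some ea1.
Proof.
move=> a0 a1; set d := emul a (orth a).
have d0 : d <> ea0.
  by move=> /M_integral[//|a'0]; apply: a1; rewrite -[a]orthK a'0.
have [b db] := emul_orth_double a; rewrite -/d in db.
have dF x : ea_le (emul (orth b) x) (orth d).
  apply: ea_le_trans (emul_le_l _ _) (orth_anti _); exact: ea_le_oplus db.
pose F x := osum d (emul (orth b) x).
have FE x : d%:fs + (emul (orth b) x)%:fs = (F x)%:fs by exact/formalP/osumP.
have nF : normal_map F.
  apply: normal_osum => // u s ui us; split; last exact: is_sup_mulr.
  by move=> n; exact/emul_ler/ui.
have [h [hE ui us]] := normal_fixpoint nF; set u := fun n => _ in ui us.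
have uu n : exists k, oplus (u n) (u n) = Some k.
  elim: n => [|n [k kE]]; first by exists ea0; exact: oplus0.
  have /formalP := emulDr (orth b) kE => bk.
  have [l bl] : exists l, oplus b (emul (orth b) k) = Some l.
    by apply/oplus_def/emul_le_l.
  exists l; apply/formalP; rewrite -[(u n.+1)%:fs]FE addrACA.
  by rewrite bk -[d%:fs + d%:fs]/(oplus d d) db.
have [y hy] : exists y, oplus h h = Some y.
  apply/oplus_def.
  have umn m n : ea_le (u m) (orth (u n)).
    have := incr_homo ui (leq_maxl m n) => mk.
    have := incr_homo ui (leq_maxr m n) => nk.
    have [k /orth_le_sum kk] := uu (maxn m n).
    by apply: ea_le_trans mk _; apply: ea_le_trans kk _; exact: orth_anti.
  apply: us.2 => n; rewrite -[u n]orthK; apply: orth_anti.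
  by apply: us.2 => m; exact: umn.
exists h; rewrite hy; congr Some.
have bby : b%:fs + (emul (orth b) y)%:fs = y%:fs.
  have /formalP <- := emulDr (orth b) hy; have /formalP <- := db.
  by rewrite addrACA !FE hE; exact/formalP.
have b_by : b = emul b y.
  apply: formal_elt_inj.
  apply: (@formal_cancel _ (emul (orth b) y)%:fs _ _ y); rewrite addrC //.
  exact: emul_orthl.
have : emul b (orth y) = ea0.
  apply: formal_elt_inj; apply: (formal_cancel (emul_orthr b y)).
  by rewrite -b_by formal0 addr0.
case/M_integral => [b0|y'0]; last by rewrite -[y]orthK y'0.
by case: d0; apply: ea_le0; rewrite -b0; exact: ea_le_oplus db.
Qed.

(** Gambler's ruin: [r], the least solution of [r = orth a + r * a * r], is
    the probability that a walk stepping up with probability [a] and down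
    otherwise ever gets below its starting point. Over the reals it is the
    minimum of [1] and [(1 - a) / a]; here this says that [orth a - a * r]
    and [orth r] multiply to [0]. *)
Lemma orth_comparable a : ea_le a (orth a) \/ ea_le (orth a) a.
Proof.
pose G x := emul (emul x a) x.
have Ga x : ea_le (G x) (orth (orth a)).
  by rewrite orthK; apply: ea_le_trans (emul_le_l _ _) (emul_le_r _ _).
pose F x := osum (orth a) (G x).
have FE x : (orth a)%:fs + (G x)%:fs = (F x)%:fs by exact/formalP/osumP.
have nG : normal_map G.
  move=> u s ui us; split.
    by move=> n; apply: emul_le; [exact/emul_lel/ui|exact: ui].
  apply: (is_sup_diag (w := fun m n => emul (emul (u m) a) (u n))
    (v := fun m => emul (emul (u m) a) s)).
  - move=> m m' n n' mm nn; apply: emul_le; last exact: incr_homo.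
    by apply: emul_lel; exact: incr_homo.
  - by move=> m; exact: is_sup_mulr.
  - apply: (is_sup_mull s (u := fun m => emul (u m) a)).
      by move=> n; exact/emul_lel/ui.
    exact: is_sup_mull.
have [r [rE ui us]] := normal_fixpoint (normal_osum Ga nG).
set u := fun n => _ in ui us.
have uS n : u n.+1 = F (u n) by [].
have au n : ea_le (emul a (u n)) (orth a).
  elim: n => [|n IH]; first by rewrite emulx0; exact: ea_ge0.
  have /formalP h := emulDr a (FE (u n)); rewrite -uS in h.
  apply/formal_leq_elt; rewrite -h -(emul_orthl a (orth a)).
  apply: formal_leqD; first exact: formal_leqxx.
  by apply/formal_leq_elt; rewrite /G !emulA -emulA; exact: emul_le.
have uC n : emul a (u n) = emul (u n) a.
  elim: n => [|n IH]; first by rewrite emulx0 emul0x.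
  apply: formal_elt_inj; rewrite uS.
  have /formalP <- := emulDr a (FE (u n)); have /formalP <- := emulDl a (FE (u n)).
  by rewrite emul_orthrC /G !emulA IH -!emulA IH.
have rC : emul a r = emul r a.
  apply: is_sup_unique (is_sup_mulr a ui us) _.
  have -> : (fun n => emul a (u n)) = (fun n => emul (u n) a) by exact/funext.
  exact: is_sup_mull.
have ca : ea_le (emul a r) (orth a) by apply: (is_sup_mulr a ui us).2.
set c := emul a r in rC ca.
have r'C : emul r (orth r) = emul (orth r) r by exact: emul_orthrC.
have a'r : emul (orth a) r = emul r (orth a).
  by symmetry; apply: emul_commute_orth.
have ar' : emul (orth a) (orth r) = emul (orth r) (orth a).
  exact: emul_commute_orth.
have rFr : (orth a)%:fs + (emul r c)%:fs = r%:fs.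
  by have := FE r; rewrite /F rE /G -emulA.
have cr' : emul c (orth r) = emul (orth a) (orth r).
  have h : (emul (orth r) (orth a))%:fs + (emul r c)%:fs = c%:fs.
    apply: (@formal_cancel _ (emul r (orth a))%:fs _ _ r).
      by rewrite addrA emul_orthl rFr.
    by rewrite addrC rC emul_orthr.
  have rcr : emul r c = emul c r by rewrite {2}rC -emulA.
  apply: formal_elt_inj; apply: (formal_cancel (emul_orthr c r)).
  by rewrite ar' -rcr addrC.
have : emul (ediff (orth a) c) (orth r) = ea0.
  by rewrite emul_ediffl// cr' ediffxx.
case/M_integral => [z0|r'0].
  by right; rewrite -(ediff_eq0 ca z0); exact: emul_le_l.
by left; move: ca; rewrite /c -[r]orthK r'0 emulx1.
Qed.

End Integral.

(** * Comparison with the unit interval *)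

Lemma i01_ea_leP (R : realType) (x y : {i01 R}) :
  @ea_le (i01_effect_algebra R) x y <-> x%:num <= y%:num.
Proof.
rewrite -i01_leP; split=> [xy|/ea_bposet_leP//].
by apply/(@ea_bposet_leP (i01_effect_algebra R)).
Qed.

Section Measure.
Variable R : realType.
Variables (M : omega_effect_monoid) (h : M).
Hypothesis hh : oplus h h = Some ea1.
Hypothesis M01 : ea0 <> ea1 :> M.
Hypothesis M_comparable : forall a : M, ea_le a (orth a) \/ ea_le (orth a) a.
Implicit Types (a b c x : M) (m n k l : nat).

Lemma half_double x : (emul h x)%:fs + (emul h x)%:fs = x%:fs.
Proof. by have /formalP := emulDl x hh; rewrite emul1x. Qed.

Lemma half_le a b : ea_le (emul h a) (emul h b) -> ea_le a b.
Proof.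
by move=> ab; exact: (oplus_le (half_double a) (half_double b) ab ab).
Qed.

Lemma half_orth a : (emul h a)%:fs + (emul h (orth a))%:fs = h%:fs.
Proof. exact: emul_orthr. Qed.

Lemma le_orth_half a : ea_le a (orth a) -> ea_le a h.
Proof.
move=> aa; apply: (oplus_le (half_double a) (half_orth a) (ea_le_refl _)).
exact: emul_ler.
Qed.

(** The midpoint of [a] and [orth b] is comparable with one half, which
    tells which of [a] and [b] is the larger. *)
Lemma ea_le_total a b : ea_le a b \/ ea_le b a.
Proof.
have h' : h = orth h by exact: orth_unique.
have [c hab] := oplus_def_le hh (emul_le_l h a) (emul_le_l h (orth b)).
have /formalP habE := hab; have hb := half_orth b.
have [/le_orth_half[d /formalP cd]|] := M_comparable c.
  left; apply: half_le; apply/formal_leq_elt; exists d%:fs.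
  apply: (@formal_cancel _ (emul h (orth b))%:fs _ _ h); first by rewrite addrC.
  by rewrite addrA [_ + (emul h a)%:fs]addrC habE.
rewrite -{2}[c]orthK => /le_orth_half/orth_anti.
rewrite -h' orthK => -[d /formalP hd].
right; apply: half_le; apply/formal_leq_elt; exists d%:fs.
apply: (@formal_cancel _ (emul h (orth b))%:fs _ _ c); first by rewrite addrC.
by rewrite addrA [_ + (emul h b)%:fs]addrC hb.
Qed.

Definition dyad n : M := iter n (emul h) ea1.

Lemma dyadD n : (dyad n.+1)%:fs + (dyad n.+1)%:fs = (dyad n)%:fs.
Proof. exact: half_double. Qed.

Lemma dyad_scale n m : (dyad n)%:fs = (dyad (m + n))%:fs *+ 2 ^ m.
Proof.
elim: m => [|m IH]; first by rewrite mulr1n.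
by rewrite IH -(dyadD (m + n)) -mulr2n -mulrnA -expnS.
Qed.

Lemma dyad_scale1 n : (dyad n)%:fs *+ 2 ^ n = ea1%:fs.
Proof. by rewrite -[X in dyad X]addn0 -dyad_scale. Qed.

Lemma dyad_neq0 n : dyad n <> ea0.
Proof.
move=> n0; have := dyad_scale1 n; rewrite n0 formal0 mul0rn => /formal_elt_inj.
exact: M01.
Qed.

Lemma dyad_leq_mul n k l : (k <= l)%N ->
  formal_leq ((dyad n)%:fs *+ k) ((dyad n)%:fs *+ l).
Proof. by move=> /subnKC <-; rewrite mulrnDr; eexists. Qed.

(** A shortage of copies would exhibit a nonzero element with sum [0], as
    [dyad n] is not [0]. *)
Lemma dyad_leq_inv n k l a : (dyad n)%:fs *+ l = a%:fs ->
  formal_leq ((dyad n)%:fs *+ k) ((dyad n)%:fs *+ l) -> (k <= l)%N.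
Proof.
move=> la [s ks]; rewrite leqNgt; apply/negP => /subnKC kl.
apply: (@dyad_neq0 n).
move: ks; rewrite -kl -addn1 -addnA mulrnDr mulrnDr mulr1n la -addrA -addrA => e.
have e0 : (dyad n)%:fs + ((dyad n)%:fs *+ (k - (l + 1)) + s) = 0.
  by apply: (formal_cancel (esym e)); rewrite addr0.
have [b bE] := formal_defr e0.
by move: e0; rewrite bE; exact: formal_add_eq0.
Qed.

(** Comparison with one half gives the first binary digit; doubling [a], or
    its excess over one half, gives the next ones. *)
Lemma dyad_expansion a n : exists k x,
  [/\ (k < 2 ^ n)%N, (dyad n)%:fs *+ k + x%:fs = a%:fs & ea_le x (dyad n)].
Proof.
elim: n a => [|n IH] a.
  by exists 0%N, a; split=> //; [rewrite add0r|exact: ea_le1].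
have low b : ea_le b h -> exists k x,
    [/\ (k < 2 ^ n)%N, (dyad n.+1)%:fs *+ k + x%:fs = b%:fs & ea_le x (dyad n.+1)].
  move=> bh; have [c bc] := oplus_def_le hh bh bh.
  have [k [x [k2 kx xn]]] := IH c.
  exists k, (emul h x); split=> //; last exact: emul_ler.
  have hcb : emul h c = b.
    apply: formal_elt_inj; have /formalP <- := emulDr h bc.
    exact: half_double.
  rewrite -hcb.
  have : forall j y z, (dyad n)%:fs *+ j + y%:fs = z%:fs ->
      (dyad n.+1)%:fs *+ j + (emul h y)%:fs = (emul h z)%:fs.
    elim=> [|j IHj] y z; first by rewrite !add0r => /formal_elt_inj ->.
    rewrite mulrSr -addrA => e; have [w wE] := formal_defr e.
    rewrite wE in e; rewrite mulrSr -addrA.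
    by have /formalP -> := emulDr h wE; exact: IHj.
  by apply.
have [/le_orth_half/low[k [x [k2 kx xn]]]|a'a] := M_comparable a.
  by exists k, x; split=> //; rewrite expnS mul2n -addnn ltn_addl.
have ha : ea_le h a.
  rewrite -[a]orthK (_ : h = orth h); last exact: orth_unique.
  by apply: orth_anti; apply: le_orth_half; rewrite orthK.
have [b hb] := ha.
have [k [x [k2 kx xn]]] : exists k x,
    [/\ (k < 2 ^ n)%N, (dyad n.+1)%:fs *+ k + x%:fs = b%:fs & ea_le x (dyad n.+1)].
  apply: low; rewrite [X in ea_le _ X](_ : h = orth h).
    exact: orth_le_sum hb.
  exact: orth_unique.
exists (2 ^ n + k)%N, x; split=> //; first by rewrite expnS mul2n -addnn ltn_add2l.
rewrite mulrnDr -addrA kx; have := dyad_scale 1 n; rewrite addn1 => <-.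
by rewrite /dyad /= emulx1; exact/formalP.
Qed.

Let frac n k : R := k%:R / 2 ^+ n.

Let pow_gt0 n : 0 < 2 ^+ n :> R. Proof. exact: exprn_gt0. Qed.

(** A dyadic rational is recorded by its exponent and its numerator. The
    preorder of formal sums puts undefined multiples of [dyad n] above
    everything, so no bound on the numerator has to be carried along. *)
Definition measure_set a : set R :=
  [set frac p.1 p.2 | p in [set p | formal_leq ((dyad p.1)%:fs *+ p.2) a%:fs]].

Definition measure a : R := sup (measure_set a).

Lemma frac_dyad_le n k m l a : (dyad m)%:fs *+ l = a%:fs ->
  formal_leq ((dyad n)%:fs *+ k) a%:fs -> frac n k <= frac m l.
Proof.
move=> la; rewrite -la (dyad_scale n m) [in X in formal_leq _ X](dyad_scale m n).
rewrite addnC -!mulrnA => /dyad_leq_inv kl.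
have {kl} : (2 ^ m * k <= 2 ^ n * l)%N.
  by apply: (kl a); rewrite -la (dyad_scale m n) -mulrnA.
rewrite -(ler_nat R) !natrM !natrX => kl.
by rewrite /frac ler_pdivrMr// mulrAC ler_pdivlMr// mulrC [_ * 2 ^+ n]mulrC.
Qed.

Lemma measure_set_sup a : has_sup (measure_set a).
Proof.
split; first by exists (frac 0 0), (0, 0)%N => //=; exists a%:fs; rewrite add0r.
exists 1 => _ [[n k] /= kn <-].
have <- : frac 0 1 = 1 by rewrite /frac expr0 divr1.
apply: (@frac_dyad_le _ _ _ _ ea1) => //.
by apply: formal_leq_trans kn _; apply/formal_leq_elt; exact: ea_le1.
Qed.

Lemma measure_ge a n k :
  formal_leq ((dyad n)%:fs *+ k) a%:fs -> frac n k <= measure a.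
Proof.
move=> kn; apply: sup_upper_bound; first exact: measure_set_sup.
by exists (n, k).
Qed.

Lemma measure_ge0 a : 0 <= measure a.
Proof.
have : frac 0 0 <= measure a.
  by apply: measure_ge; exists a%:fs; rewrite add0r.
by rewrite /frac mul0r.
Qed.

Lemma measure_le1 a : measure a <= 1.
Proof.
apply: ge_sup; first by have [] := measure_set_sup a.
move=> _ [[n k] /= kn <-].
have <- : frac 0 1 = 1 by rewrite /frac expr0 divr1.
apply: (@frac_dyad_le _ _ _ _ ea1) => //.
by apply: formal_leq_trans kn _; apply/formal_leq_elt; exact: ea_le1.
Qed.

Lemma measure_le a n k :
  formal_leq a%:fs ((dyad n)%:fs *+ k) -> measure a <= frac n k.
Proof.
move=> ak; have [k2|k2] := leqP k (2 ^ n); last first.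
  apply: le_trans (measure_le1 a) _; rewrite /frac ler_pdivlMr// mul1r.
  by rewrite -natrX ler_nat ltnW.
have [c cE] : exists c, (dyad n)%:fs *+ k = c%:fs.
  by apply: (@formal_leq_def _ _ ea1); rewrite -(dyad_scale1 n); exact: dyad_leq_mul.
apply: ge_sup; first by have [] := measure_set_sup a.
move=> _ [[m l] /= lm <-]; apply: (frac_dyad_le cE).
by apply: formal_leq_trans lm _; rewrite -cE.
Qed.

Lemma measure_approx a n : exists k x,
  [/\ (dyad n)%:fs *+ k + x%:fs = a%:fs, ea_le x (dyad n),
      frac n k <= measure a & measure a <= frac n k.+1].
Proof.
have [k [x [_ kx xn]]] := dyad_expansion a n; exists k, x; split=> //.
  by apply: measure_ge; rewrite -kx; exists x%:fs.
apply: measure_le; rewrite -kx mulrSr; apply: formal_leqD.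
  exact: formal_leqxx.
exact/formal_leq_elt.
Qed.

Lemma small_eq0 (r c : R) : (forall n, `|r| <= c / 2 ^+ n) -> r = 0.
Proof.
move=> rc; apply/eqP; rewrite -normr_eq0; apply/eqP/le_anti.
rewrite normr_ge0 andbT; apply/ler_addgt0Pr => e e0; rewrite add0r.
have c0 : 0 <= c by have := rc 0%N; rewrite expr0 divr1; exact: le_trans.
apply: le_trans (rc (Num.truncn (c / e))) _.
rewrite ler_pdivrMr// mulrC -ler_pdivrMr//.
apply: ltW; apply: lt_le_trans (truncnS_gt _) _.
by rewrite -natrX ler_nat ltn_expl.
Qed.

(** The bounds of [measure_approx] for [a] and [b] add up to bounds for [c]
    that are [2 / 2 ^+ n] apart. *)
Lemma measureD a b c : oplus a b = Some c -> measure c = measure a + measure b.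
Proof.
move=> /formalP abc; apply/eqP; rewrite -subr_eq0; apply/eqP.
apply: (@small_eq0 _ 2) => n.
have [k [x [kx xn ka ak]]] := measure_approx a n.
have [l [y [ly yn lb bl]]] := measure_approx b n.
have klc : frac n (k + l) <= measure c.
  apply: measure_ge; rewrite -abc -kx -ly addrACA mulrnDr.
  by exists (x%:fs + y%:fs).
have ckl : measure c <= frac n (k.+1 + l.+1).
  apply: measure_le; rewrite -abc -kx -ly mulrnDr !mulrSr.
  by apply: formal_leqD; apply: formal_leqD; rewrite ?formal_leq_elt//;
    exact: formal_leqxx.
move: klc ckl ka ak lb bl; rewrite /frac !natrD -!natr1 !mulrDl.
set i := _^-1; rewrite mul1r.
by move=> *; rewrite ler_norml; apply/andP; split; lra.
Qed.

Lemma measure1 : measure ea1 = 1.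
Proof.
apply/le_anti; rewrite measure_le1 /= -[1](divr1 1) -(expr0 2).
by apply: (@measure_ge _ 0%N 1%N); exact: formal_leqxx.
Qed.

(** Such an [a] lies below every [dyad n], so the increasing sequence of the
    [orth (dyad n)] can absorb it at every step. *)
Lemma measure_eq0 a : measure a = 0 -> a = ea0.
Proof.
move=> a0; have ad n : ea_le a (dyad n).
  have [k [x [kx xn]]] := measure_approx a n; rewrite a0 => k0 _.
  suff k00 : k = 0%N.
    by move: kx; rewrite k00 add0r => /formal_elt_inj <-.
  apply/eqP; rewrite -leqn0 -(ler_nat R).
  by move: k0; rewrite /frac ler_pdivrMr// mul0r.
pose u n := orth (dyad n).
have step n c : ea_le c (dyad n.+1) ->
    exists2 d, oplus c (u n) = Some d & ea_le d (u n.+1).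
  move=> cd.
  have uS : oplus (dyad n.+1) (u n) = Some (u n.+1).
    apply/formalP; apply: (@formal_cancel _ (dyad n.+1)%:fs _ _ ea1).
      by rewrite addrA dyadD formal_orth.
    exact: formal_orth.
  have [d cud] := oplus_def_le uS cd (ea_le_refl (u n)).
  by exists d => //; exact: oplus_le cud uS cd (ea_le_refl _).
have ui : incr u.
  move=> n; have [d /oplusC/ea_le_oplus ud du] := step n _ (ea_ge0 _).
  exact: ea_le_trans ud du.
by apply: (is_sup_archimedean (esupP ui)) => n; exact: step.
Qed.

Lemma measure_homo a b : ea_le a b -> measure a <= measure b.
Proof. by move=> [c /measureD ->]; rewrite lerDl measure_ge0. Qed.

Lemma measure_leE a b : measure a <= measure b -> ea_le a b.
Proof.
have [//|[c bc]] := ea_le_total a b.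
rewrite (measureD bc) gerDl => c0.
have c00 : c = ea0 by apply: measure_eq0; apply/le_anti; rewrite c0 measure_ge0.
by move: bc; rewrite c00 oplus0 => -[->]; exact: ea_le_refl.
Qed.

(** An additive function is determined on multiples of [dyad n] by its value
    at [1], and elsewhere up to [g ea1 / 2 ^+ n] by monotonicity. *)
Lemma additive_measure (g : M -> R) : (forall a, 0 <= g a) ->
  (forall a b c, oplus a b = Some c -> g c = g a + g b) ->
  forall a, g a = g ea1 * measure a.
Proof.
move=> g0 gD a; apply/eqP; rewrite -subr_eq0; apply/eqP.
apply: (@small_eq0 _ (g ea1)) => n.
have gd m : g (dyad m) = g ea1 / 2 ^+ m.
  elim: m => [|m IH]; first by rewrite expr0 divr1.
  have /formalP/gD := dyadD m; rewrite IH exprS invfM mulrCA => e.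
  by rewrite e; lra.
have [k [x [kx xn ka ak]]] := measure_approx a n.
have ga : g a = k%:R * g (dyad n) + g x.
  elim: k {ka ak} a kx => [|k IH] a.
    by rewrite add0r mul0r add0r => /formal_elt_inj ->.
  rewrite mulrSr addrAC => e; have [b bE] := formal_defl e.
  rewrite bE in e; rewrite (gD _ _ _ e) (IH _ bE) -natr1 mulrDl mul1r.
  by rewrite addrAC.
have gx : g x <= g (dyad n).
  by have [y /gD ->] := xn; rewrite lerDl.
have gx0 := g0 x; have g10 := g0 ea1.
move: ka ak; rewrite /frac -[k.+1%:R]natr1 mulrDl mul1r => ka ak.
have := ler_wpM2l g10 ka; have := ler_wpM2l g10 ak.
rewrite {}ga gd in gx *; rewrite mulrDr mulrCA => ? ?.
by rewrite ler_norml; apply/andP; split; lra.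
Qed.

Lemma measureM a b : measure (emul a b) = measure a * measure b.
Proof.
rewrite (@additive_measure (fun a => measure (emul a b))) ?emul1x 1?mulrC//.
  by move=> c; exact: measure_ge0.
by move=> c d e cde; apply: measureD; exact: emulDl.
Qed.

Lemma measure_dyad n : measure (dyad n) = (2 ^+ n)^-1.
Proof.
elim: n => [|n IH]; first by rewrite measure1 expr0 invr1.
have := measureD hh; rewrite measure1 => hE.
rewrite (_ : dyad n.+1 = emul h (dyad n))// measureM IH exprS invfM.
by congr (_ * _); lra.
Qed.

(** The supremum of the truncated binary expansions of [r]. *)
Lemma measure_surj (r : R) : 0 <= r <= 1 -> exists a, measure a = r.
Proof.
move=> /andP[r0 r1]; pose k n := Num.truncn (r * 2 ^+ n).
have rn0 n : 0 <= r * 2 ^+ n by rewrite mulr_ge0// ltW.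
have v_ex n : exists a, (dyad n)%:fs *+ k n = a%:fs.
  apply: (@formal_leq_def _ _ ea1); rewrite -(dyad_scale1 n).
  apply: dyad_leq_mul; rewrite -(ler_nat R) natrX.
  by apply: le_trans (_ : r * 2 ^+ n <= _); rewrite ?truncn_le// ler_piMl// ltW.
have {v_ex} [v vE] := choice v_ex.
have mv n : measure (v n) = frac n (k n).
  apply/le_anti/andP; split.
    by apply: measure_le; rewrite vE; exact: formal_leqxx.
  by apply: measure_ge; rewrite vE; exact: formal_leqxx.
have vr n : measure (v n) <= r.
  by rewrite mv /frac ler_pdivrMr// truncn_le.
have rv n : r <= measure (v n) + (2 ^+ n)^-1.
  rewrite mv /frac -{2}[_^-1]mul1r -mulrDl natr1 ler_pdivlMr//.
  exact/ltW/truncnS_gt.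
have vi : incr v.
  move=> n; apply: measure_leE; rewrite !mv /frac exprS invfM mulrA.
  rewrite ler_pM2r ?invr_gt0// ler_pdivlMr//.
  have : (k n * 2)%N%:R <= (k n.+1)%:R :> R.
    rewrite ler_nat truncn_ge_nat// exprS mulrCA mulrC natrM ler_pM2r//.
    by rewrite truncn_le.
  by rewrite natrM.
have [vs sv] := esupP vi; set s := esup v in vs sv.
exists s; apply/le_anti/andP; split; last first.
  apply/ler_addgt0Pr => e e0; have := rv (Num.truncn e^-1).
  move=> /le_trans; apply; apply: lerD; first exact/measure_homo/vs.
  rewrite -[leRHS]invrK lef_pV2 ?posrE ?invr_gt0//.
  apply: ltW; apply: lt_le_trans (truncnS_gt _) _.
  by rewrite -natrX ler_nat ltn_expl.
rewrite leNgt; apply/negP => rs.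
(* a dyadic step below [s] would still bound the sequence *)
have [n dn] : exists n, (2 ^+ n)^-1 < measure s - r.
  exists (Num.truncn (measure s - r)^-1).
  rewrite -[ltRHS]invrK ltf_pV2 ?posrE ?invr_gt0 ?subr_gt0//.
  apply: lt_le_trans (truncnS_gt _) _.
  by rewrite -natrX ler_nat ltn_expl.
have [t dt] : ea_le (dyad n) s.
  by apply: measure_leE; rewrite measure_dyad; lra.
have := measureD dt; rewrite measure_dyad => st.
have : ea_le s t.
  apply: sv => m; apply: measure_leE; apply: le_trans (vr m) _; lra.
move=> /measure_homo; have := pow_gt0 n; rewrite -invr_gt0; lra.
Qed.

Definition measure01 a : {i01 R} := Itv01 (measure_ge0 a) (measure_le1 a).

Lemma measure_isomorphic : @isomorphic OmegaEM M (unit_interval R).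
Proof.
pose f a : unit_interval R := measure01 a.
have f_leP a b : ea_le (f a) (f b) <-> ea_le a b.
  split=> [/i01_ea_leP|ab]; first exact: measure_leE.
  by apply/i01_ea_leP; exact: measure_homo.
have f1 : f ea1 = ea1 by apply: val_inj; rewrite /= measure1 subr0.
have f_le a b : ea_le a b -> ea_le (f a) (f b) by move=> ab; exact/f_leP.
have fd a b : ea_le a b -> f (ediff b a) = ediff (f b) (f a).
  move=> ab; symmetry; apply: ediff_oplus; apply/i01_oplusP.
  by rewrite /= (measureD (oplus_ediff ab)).
have fM a b : f (emul a b) = emul (f a) (f b).
  by apply: val_inj; rewrite /= measureM.
have f_surj (y : unit_interval R) : exists x, f x = y.
  have [|x xy] := @measure_surj (y : {i01 R})%:num; first by apply/andP.
  by exists x; apply: val_inj.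
have fs (u : nat -> M) s : incr u -> is_sup u s -> is_sup (f \o u) (f s).
  move=> ui [us su]; split=> [n|y fuy]; first exact/f_le/us.
  have [x xy] := f_surj y; rewrite -xy; apply/f_leP/su => n.
  by apply/f_leP; rewrite xy; exact: fuy.
exists (mk_oem_hom f1 f_le fd fM fs).
by apply: oem_bijective_is_iso => // a b /f_leP.
Qed.

End Measure.

Lemma unit_interval_connected (R : realType) : connected (unit_interval R).
Proof.
move=> e /(congr1 (fun x : {i01 R} => x%:num)) /= ee.
have /eqP : (e : {i01 R})%:num * ((e : {i01 R})%:num - 1) = 0.
  by rewrite mulrBr ee mulr1 subrr.
rewrite mulf_eq0 subr_eq0 => /orP[/eqP e0|/eqP e1]; [left|right].
  exact: val_inj.
by apply: val_inj; rewrite /= subr0.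
Qed.

Lemma unit_interval_half (R : realType) :
  exists h : unit_interval R, oplus h h = Some ea1.
Proof.
have h0 : (0 : R) <= 2^-1 by rewrite invr_ge0.
have h1 : (2^-1 : R) <= 1 by lra.
exists (Itv01 h0 h1 : {i01 R}); apply/i01_oplusP => /=; lra.
Qed.

Lemma unit_interval_neq01 (R : realType) : ea0 <> ea1 :> unit_interval R.
Proof.
move=> /(congr1 (fun x : {i01 R} => x%:num)) /= /eqP.
by rewrite subr0 eq_sym oner_eq0.
Qed.

(** An omega-effect monoid without elements other than [0] and [1] would be
    initial, so there is a coin to start from. *)
Lemma irreducible_unit_interval (R : realType) (M : OmegaEM) :
  ~ initial M -> ~ final M -> irreducible M -> isomorphic M (unit_interval R).
Proof.
move=> Mi Mf /irreducible_connected Mc.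
have M01 : ea0 <> ea1 :> M by move=> /finalP.
have M_int (x y : M) := @connected_integral M x y Mc.
have [h hh] : exists h : M, oplus h h = Some ea1.
  apply: contrapT => nh; apply/Mi/(two_element_initial M01) => x.
  apply: contrapT => /not_orP[x0 x1]; apply: nh.
  exact: (half_exists M_int x0 x1).
exact: (measure_isomorphic R hh M01 (orth_comparable M_int)).
Qed.

Theorem corollary39 (R : realType) :
  exists (T : monad BPos) (F : functor (EilenbergMoore T) OmegaEM)
         (G : functor OmegaEM (EilenbergMoore T)),
    quasi_inverse F G /\
    [/\ ~ initial (G (unit_interval R)),
        ~ final (G (unit_interval R)),
        irreducible (G (unit_interval R)) &
        forall A : EilenbergMoore T,
          ~ initial A -> ~ final A -> irreducible A ->
          isomorphic A (G (unit_interval R))].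
Proof.
have FG := alg_oem_quasi_inverse; have GF := quasi_inverse_sym FG.
exists free_monad, alg_to_oem, oem_to_alg; split=> //; split.
- have [h hh] := unit_interval_half R.
  by move=> /(quasi_inverse_reflect_initial GF)/(@initial_no_half _ h).
- move=> /(quasi_inverse_reflect_final GF)/finalP.
  exact: unit_interval_neq01.
- apply: quasi_inverse_irreducible FG _.
  exact/connected_irreducible/unit_interval_connected.
- move=> A Ai Af Airr.
  apply: (@isomorphic_trans _ _ (oem_to_alg (alg_to_oem A))).
    by have [[t ti] _] := FG; exists (t A); exact: ti.
  apply: isomorphic_fmap; apply: irreducible_unit_interval.
  + by move=> /(quasi_inverse_reflect_initial FG).
  + by move=> /(quasi_inverse_reflect_final FG).
  + exact: quasi_inverse_irreducible GF Airr.
Qed.
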